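(* There exists an absolute constant $\alpha>0$ such that for every $p>8$, every $E>0$, and every closed, compact and connected Lipschitz surface $\Sigma\subset\mathbb{R}^3$ with $\mathcal{M}_p(\Sigma)\le E$ the following estimates hold: $$\operatorname{diam}\Sigma\ \ge\ \left(\frac{\alpha^{5p}}{E}\right)^{\frac{1}{p-8}},$$ $$\mathcal{H}^2(\Sigma\cap B(x,R))\ \ge\ \frac{\pi}{2}R^2\qquad\text{for all } x\in\Sigma \text{ and all } R\in\Bigl(0,\bigl(\alpha^{5p}/E\bigr)^{1/(p-8)}\Bigr].$$
   Context: $B(x,r)$ denotes the closed ball of radius $r$ centered at $x\in\mathbb{R}^3$, and $\mathcal{H}^2$ the two-dimensional Hausdorff measure. A closed, compact and connected Lipschitz surface is a compact connected set $\Sigma\subset\mathbb{R}^3$ with $\Sigma=\partial U$ for some bounded domain $U\subset\mathbb{R}^3$, such that near each of its points $\Sigma$ is, after a rigid motion, the graph of a Lipschitz function of two variables. For a tetrahedron $T=(x_0,x_1,x_2,x_3)\in(\mathbb{R}^3)^4$ put $\mathcal{K}(T)=\dfrac{V(T)}{A(T)(\operatorname{diam}T)^2}$ if the four vertices are not co-planar, and $\mathcal{K}(T)=0$ otherwise, where $V(T)$ is the volume of $T$ and $A(T)$ is the sum of the areas of its four triangular faces. The integral Menger curvature is $\mathcal{M}_p(\Sigma)=\int_{\Sigma}\int_\Sigma\int_\Sigma\int_\Sigma\mathcal{K}^p(x_0,x_1,x_2,x_3)\,d\mathcal{H}^2(x_0)\,d\mathcal{H}^2(x_1)\,d\mathcal{H}^2(x_2)\,d\mathcal{H}^2(x_3)$.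 *)

(* Defs.v *)
From HB Require Import structures.
From mathcomp Require Import all_boot all_order all_algebra.
From mathcomp Require Import all_classical all_reals all_analysis.
Set Implicit Arguments.
Unset Strict Implicit.
Unset Printing Implicit Defensive.
Import Order.TTheory GRing.Theory Num.Theory.
Import numFieldNormedType.Exports.
Local Open Scope classical_set_scope.
Local Open Scope ring_scope.

(* The library norm on 'rV[R]_n is the sup norm, so metric
   notions are built on [enorm]; the topology of 'rV[R]_n is the usual one. *)

Definition dot (R : realType) (n : nat) (u v : 'rV[R]_n) : R :=
  \sum_(i < n) u 0 i * v 0 i.

Definition enorm (R : realType) (n : nat) (u : 'rV[R]_n) : R :=
  Num.sqrt (dot u u).

Definition ecball (R : realType) (n : nat) (x : 'rV[R]_n) (r : R) :
    set 'rV[R]_n :=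
  [set y | enorm (y - x) <= r].

(* Adjoining 0 only matters for the empty set, whose diameter is then 0. *)
Definition ediam (R : realType) (n : nat) (A : set 'rV[R]_n) : \bar R :=
  ereal_sup (0%E |` [set (enorm (p.1 - p.2))%:E | p in A `*` A]).

Definition fine_cover (R : realType) (n : nat) (delta : R) (A : set 'rV[R]_n) :
    set ((set 'rV[R]_n)^nat) :=
  [set C | A `<=` \bigcup_k C k /\ forall k, (ediam (C k) <= delta%:E)%E].

(* The factor pi / 4, the area of a disc of diameter 1, makes the measure agree
   with Lebesgue measure on planes. *)
Definition hausdorff2_delta (R : realType) (n : nat) (delta : R)
    (A : set 'rV[R]_n) : \bar R :=
  ereal_inf [set (\sum_(k <oo) (pi / 4)%:E * ediam (C k) ^+ 2)%E
            | C in fine_cover delta A].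

Definition hausdorff2 (R : realType) (n : nat) (A : set 'rV[R]_n) : \bar R :=
  ereal_sup [set hausdorff2_delta delta A | delta in [set d : R | 0 < d]].

Section hausdorff2_outer_measure.
Context (R : realType) (n : nat).
Implicit Types (A : set 'rV[R]_n) (delta : R).
Local Open Scope ereal_scope.

Lemma ediam_ge0 A : 0 <= ediam A.
Proof. by apply: ereal_sup_ubound; left. Qed.

Lemma ediam0 : ediam (@set0 'rV[R]_n) = 0.
Proof.
apply/eqP; rewrite eq_le ediam_ge0 andbT; apply: ge_ereal_sup => z [->//|].
by case=> -[x y] /= [].
Qed.

Let area A : \bar R := (pi / 4)%:E * ediam A ^+ 2.

Let area_ge0 A : 0 <= area A.
Proof.
rewrite /area expe2 mule_ge0 ?mule_ge0 ?ediam_ge0//.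
by rewrite lee_fin divr_ge0// pi_ge0.
Qed.

Lemma hausdorff2_delta_ge0 delta A : 0 <= hausdorff2_delta delta A.
Proof.
apply: le_ereal_inf_tmp => _ [C _ <-].
by apply: nneseries_ge0 => k _ _; exact: area_ge0.
Qed.

Lemma hausdorff2_delta0 delta : (0 < delta)%R ->
  hausdorff2_delta delta (@set0 'rV[R]_n) = 0.
Proof.
move=> d0; apply/eqP; rewrite eq_le hausdorff2_delta_ge0 andbT.
apply: ereal_inf_lbound; exists (fun=> set0).
  by split => // k; rewrite ediam0 lee_fin ltW.
by apply: eseries0 => k _ _; rewrite ediam0 expe2 mul0e mule0.
Qed.

Lemma hausdorff2_delta_sigma_subadditive delta :
  sigma_subadditive (@hausdorff2_delta R n delta).
Proof.
move=> A; set H := @hausdorff2_delta R n delta.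
have H0 B : 0 <= H B by exact: hausdorff2_delta_ge0.
have [[i ioo]|] := pselect (exists i, H (A i) = +oo).
  rewrite (eseries_pinfty _ _ ioo) ?leey// => k _.
  by rewrite -ltNye (lt_le_trans _ (H0 (A k))).
rewrite -forallNE => Aoo.
suff add2e (e : {posnum R}) :
    H (\bigcup_n A n) <= \sum_(i <oo) H (A i) + e%:num%:E.
  by apply/lee_addgt0Pr => _/posnumP[].
rewrite (le_trans _ (epsilon_trick _ _ _))//.
pose P k (B : (set 'rV[R]_n)^nat) := fine_cover delta (A k) B /\
  \sum_(j <oo) area (B j) <= H (A k) + (e%:num / (2 ^ k.+1)%:R)%:E.
have [G PG] : {G : ((set 'rV[R]_n)^nat)^nat & forall k, P k (G k)}.
  apply: (@choice _ _ P) => k; rewrite /P /H /hausdorff2_delta.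
  set S := (X in ereal_inf X); move infS : (ereal_inf S) => iS.
  case: iS infS => [r Sr|Soo|Soo].
  - have en1 : (0 < e%:num / (2 ^ k.+1)%:R)%R by [].
    have /(lb_ereal_inf_adherent en1) : ereal_inf S \is a fin_num by rewrite Sr.
    move=> [x [B mB muBx] xS].
    by exists B; split => //; rewrite muBx -Sr; exact/ltW.
  - by have := Aoo k; rewrite /H /hausdorff2_delta Soo.
  - suff : lbound S 0 by move/le_ereal_inf_tmp; rewrite Soo.
    by move=> /= _ [B mB <-]; by apply: nneseries_ge0 => ? _ _; exact: area_ge0.
have aG_ge0 x : 0 <= (area \o uncurry G) x by exact: area_ge0.
apply: (@le_trans _ _ (\esum_(i in setT) (area \o uncurry G) i)).
  apply: ereal_inf_lbound => /=.
  have /card_esym/ppcard_eqP[f] := card_nat2.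
  exists (uncurry G \o f).
    split => [|i]; last first.
      by rewrite /=; case: (f i) => a b /=; exact: (PG a).1.2.
    apply: (@subset_trans _ (\bigcup_n \bigcup_k G n k)) => [t [i _]|].
      by move=> /((PG i).1.1) -[j _ ?]; exists i => //; exists j.
    move=> t [i _ [j _ Bijt]]; exists (f^-1%FUN (i, j)) => //=.
    by rewrite invK ?inE.
  rewrite -(esum_pred_image (area \o uncurry G) _ xpredT) ?[fun=> _]set_true//.
  by rewrite image_eq.
rewrite (_ : esum _ _ = \sum_(i <oo) \sum_(j <oo ) area (G i j)); last first.
  pose J : nat -> set (nat * nat) := fun i => [set (i, j) | j in setT].
  rewrite (_ : setT = \bigcup_k J k); last first.
    by rewrite predeqE => -[a b]; split => // _; exists a => //; exists b.
  rewrite esum_bigcupT /=; last 2 first.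
    - apply/trivIsetP => i j _ _ ij.
      rewrite predeqE => -[k m] /=; split => //= -[] [_] _ [<-{k} _].
      by move=> [m' _] [] /esym/eqP; rewrite (negbTE ij).
    - by move=> /= x; exact: aG_ge0.
  rewrite -(image_id [set: nat]) -fun_true esum_pred_image//; last first.
    by move=> k _; exact: esum_ge0.
  apply: eq_eseriesr => /= j _.
  rewrite -(esum_pred_image (area \o uncurry G) (pair j) predT)//=; last first.
    by move=> ? ? _ _; exact: (@can_inj _ _ _ snd).
  by congr esum; rewrite predeqE => -[a b]; split; move=> [i _ <-]; exists i.
apply: lee_lim.
- apply: is_cvg_nneseries => k *.
  by apply: nneseries_ge0 => m *; exact: (aG_ge0 (k, m)).
- by apply: is_cvg_nneseries => k *; apply: adde_ge0 => //; exact: H0.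
- by near=> k; apply: lee_sum => i _; exact: (PG i).2.
Unshelve. all: by end_near. Qed.

Lemma hausdorff2_ge0 A : 0 <= hausdorff2 A.
Proof.
apply: (le_trans (hausdorff2_delta_ge0 1 A)).
by apply: ereal_sup_ubound; exists 1%R => //=.
Qed.

Lemma hausdorff20 : hausdorff2 (@set0 'rV[R]_n) = 0.
Proof.
apply/eqP; rewrite eq_le hausdorff2_ge0 andbT.
by apply: ge_ereal_sup => _ [d /= d0 <-]; rewrite hausdorff2_delta0.
Qed.

Lemma le_hausdorff2 : {homo @hausdorff2 R n : A B / A `<=` B >-> A <= B}.
Proof.
move=> A B AB; apply: ge_ereal_sup => _ [d /= d0 <-].
apply: (@le_trans _ _ (hausdorff2_delta d B)).
  apply/ereal_inf_le_tmp => _ [C [BC Cd] <-]; exists C => //; split => //.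
  exact: subset_trans BC.
by apply: ereal_sup_ubound; exists d.
Qed.

Lemma hausdorff2_sigma_subadditive : sigma_subadditive (@hausdorff2 R n).
Proof.
move=> A; apply: ge_ereal_sup => _ [d /= d0 <-].
apply: (le_trans (hausdorff2_delta_sigma_subadditive d A)).
apply: lee_nneseries => k _; first by move=> _; exact: hausdorff2_delta_ge0.
by apply: ereal_sup_ubound; exists d.
Qed.

HB.instance Definition _ := isOuterMeasure.Build R 'rV[R]_n (@hausdorff2 R n)
  hausdorff20 hausdorff2_ge0 le_hausdorff2 hausdorff2_sigma_subadditive.

End hausdorff2_outer_measure.

(* 'rV[R]_3 with the sigma-algebra of Caratheodory H^2-measurable sets, on which
   H^2 is a measure. It contains the Borel sets, H^2 being a metric outer
   measure. *)
Definition H2_outer (R : realType) : {outer_measure set 'rV[R]_3 -> \bar R} :=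
  @hausdorff2 R 3.

Definition H2space (R : realType) := caratheodory_type (H2_outer R).

HB.instance Definition _ (R : realType) :=
  Measurable.copy (H2space R) (caratheodory_type (H2_outer R)).

Definition H2 (R : realType) : {measure set (H2space R) -> \bar R} :=
  H2_outer R : set (caratheodory_type (H2_outer R)) -> \bar R.

Definition domain (R : realType) (U : set 'rV[R]_3) : Prop :=
  [/\ U !=set0, open U & connected U].

Definition frontier (T : topologicalType) (A : set T) : set T :=
  closure A `\` interior A.

Definition rigid_motion (R : realType) (phi : 'rV[R]_3 -> 'rV[R]_3) : Prop :=
  exists (Q : 'M[R]_3) (b : 'rV[R]_3),
    [/\ Q *m Q^T = 1%:M, \det Q = 1 & forall y, phi y = y *m Q + b].

Definition elipschitz (R : realType) (f : 'rV[R]_2 -> R) : Prop :=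
  exists L : R, forall u v, `|f u - f v| <= L * enorm (u - v).

Definition graph2 (R : realType) (f : 'rV[R]_2 -> R) : set 'rV[R]_3 :=
  [set (row_mx u (f u)%:M : 'rV[R]_(2 + 1)) | u in setT].

Definition lipschitz_surface (R : realType) (Sigma : set 'rV[R]_3) : Prop :=
  [/\ compact Sigma, connected Sigma,
      exists2 U : set 'rV[R]_3, domain U /\ bounded_set U & Sigma = frontier U
    & forall x, Sigma x ->
        exists (phi : 'rV[R]_3 -> 'rV[R]_3) (f : 'rV[R]_2 -> R),
        [/\ rigid_motion phi, elipschitz f &
            \forall y \near x, Sigma y <-> graph2 f (phi y)]].

Definition coplanar (R : realType) (T : 'I_4 -> 'rV[R]_3) : Prop :=
  exists (nu : 'rV[R]_3) (c : R), nu != 0 /\ forall i, dot nu (T i) = c.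

(* Half the area of the parallelogram spanned by b - a and c - a, the latter
   being the square root of the Gram determinant. *)
Definition triangle_area (R : realType) (n : nat) (a b c : 'rV[R]_n) : R :=
  Num.sqrt (dot (b - a) (b - a) * dot (c - a) (c - a) - dot (b - a) (c - a) ^+ 2)
  / 2.

Definition tetra_volume (R : realType) (T : 'I_4 -> 'rV[R]_3) : R :=
  `|\det (\matrix_(i < 3) (T (lift ord0 i) - T ord0))| / 6.

(* [T (lift i j)], j < 3, are the vertices of the face opposite to [T i]. *)
Definition tetra_area (R : realType) (T : 'I_4 -> 'rV[R]_3) : R :=
  \sum_(i < 4) triangle_area (T (lift i (inord 0))) (T (lift i (inord 1)))
                             (T (lift i (inord 2))).

Definition tetra_diam (R : realType) (T : 'I_4 -> 'rV[R]_3) : R :=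
  \big[Num.max/0]_(i < 4) \big[Num.max/0]_(j < 4) enorm (T i - T j).

Definition tetra (R : realType) (x0 x1 x2 x3 : 'rV[R]_3) : 'I_4 -> 'rV[R]_3 :=
  fun i => nth 0 [:: x0; x1; x2; x3] i.

Definition menger_kernel (R : realType) (T : 'I_4 -> 'rV[R]_3) : R :=
  if `[< coplanar T >] then 0
  else tetra_volume T / (tetra_area T * tetra_diam T ^+ 2).

Definition menger_curvature (R : realType) (p : R) (Sigma : set 'rV[R]_3) :
    \bar R :=
  (\int[H2 R]_(x3 in (Sigma : set (H2space R)))
   \int[H2 R]_(x2 in (Sigma : set (H2space R)))
   \int[H2 R]_(x1 in (Sigma : set (H2space R)))
   \int[H2 R]_(x0 in (Sigma : set (H2space R)))
     (menger_kernel (tetra x0 x1 x2 x3) `^ p)%:E)%E.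

(* Main.v *)
Require Import Defs.
From mathcomp Require Import all_boot all_order all_algebra.
From mathcomp Require Import all_classical all_reals all_analysis.
From mathcomp Require Import ring lra.
Set Implicit Arguments.
Unset Strict Implicit.
Unset Printing Implicit Defensive.
Import Order.TTheory GRing.Theory Num.Theory.
Import numFieldNormedType.Exports.
Local Open Scope classical_set_scope.
Local Open Scope ring_scope.

(** Write [S] for the surface, the frontier of the bounded domain [U].  The proof
    goes up through the scales and keeps the following invariant ([split_at]):
    at every point [x] of [S] there is a plane such that, outside a slab of
    half-width [r / 10] around it, one half of the ball of radius [r] lies in [U]
    and the other half in the complement of [U].

    The invariant gives both estimates.  Every segment across the slab meets
    [S] ([segment_meets_frontier]), so [S] inside the ball projects onto a disc
    of radius [r * Num.sqrt (89 / 100)] in the plane ([split_projection]); hence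
    the lower bound for the area ([split_hausdorff2]) and for the diameter
    ([split_ediam]).  The area of a projection is compared with the Hausdorff
    measure by putting each covering set into a square; the loss against the
    isodiametric inequality is affordable because the target is only half the
    area of the disc.

    From scale [r / 2] to scale [r]: if [S] were not flat in the ball of radius
    [r], there would be a tetrahedron with vertices on [S] and volume comparable
    to [r ^+ 3] ([wide_triple]).  Its kernel, and that of all tetrahedra with
    nearby vertices, is at least a constant over [r], and by the area bound at
    smaller scales the nearby vertices fill a mass comparable to [r ^+ 2] each.
    So the energy is at least a constant to the power [p] times [r `^ (8 - p)],
    which is more than [E] as long as [r] is below the threshold of the theorem
    ([flat_of_energy], [energy_threshold]).  Hence [S] is flat at scale [r].
    The balls in [U] and in its complement known from scale [r / 2] are too big
    for the thin slab around [S], so [U] fills one side of the slab and misses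
    the other ([split_of_flat]).

    The start of the induction is where the Lipschitz charts are needed.  They
    give an area bound and balls on both sides of [S], uniformly by compactness,
    but with constants that depend on the Lipschitz constant.  The same energy
    argument with these constants works at sufficiently small scales because
    [8 < p] ([split_small_scales]).  That [U] lies on one side of the charts only
    follows from the connectedness of [S] and the boundedness of [U]
    ([frontier_no_slit]). *)

(** * Euclidean geometry *)

Section euclidean.
Context (R : realType) (n : nat).
Implicit Types (u v w x y z : 'rV[R]_n) (a : R).

Lemma dotC u v : dot u v = dot v u.
Proof. by apply: eq_bigr => i _; rewrite mulrC. Qed.

Lemma dotDl u v w : dot (u + v) w = dot u w + dot v w.
Proof. by rewrite -big_split; apply: eq_bigr => i _; rewrite mxE mulrDl. Qed.

Lemma dotZl a u v : dot (a *: u) v = a * dot u v.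
Proof. by rewrite mulr_sumr; apply: eq_bigr => i _; rewrite mxE mulrA. Qed.

Lemma dotNl u v : dot (- u) v = - dot u v.
Proof. by rewrite -scaleN1r dotZl mulN1r. Qed.

Lemma dotBl u v w : dot (u - v) w = dot u w - dot v w.
Proof. by rewrite dotDl dotNl. Qed.

Lemma dotDr u v w : dot u (v + w) = dot u v + dot u w.
Proof. by rewrite dotC dotDl !(dotC _ u). Qed.

Lemma dotZr a u v : dot u (a *: v) = a * dot u v.
Proof. by rewrite dotC dotZl dotC. Qed.

Lemma dotNr u v : dot u (- v) = - dot u v.
Proof. by rewrite dotC dotNl dotC. Qed.

Lemma dotBr u v w : dot u (v - w) = dot u v - dot u w.
Proof. by rewrite dotDr dotNr. Qed.

Lemma dot0l u : dot 0 u = 0.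
Proof. by rewrite -(scale0r 0) dotZl mul0r. Qed.

Definition dotE := (dotDl, dotDr, dotNl, dotNr, dotZl, dotZr).

Lemma dot_ge0 u : 0 <= dot u u.
Proof. by apply: sumr_ge0 => i _; rewrite -expr2 sqr_ge0. Qed.

Lemma dot_eq0 u : dot u u = 0 -> u = 0.
Proof.
move/eqP; rewrite psumr_eq0 => [/allP u0|i _]; last by rewrite -expr2 sqr_ge0.
apply/rowP => i; rewrite mxE.
by have := u0 i (mem_index_enum i); rewrite -expr2 sqrf_eq0 => /eqP.
Qed.

Lemma enorm_ge0 u : 0 <= enorm u.
Proof. exact: sqrtr_ge0. Qed.

Lemma sqr_enorm u : enorm u ^+ 2 = dot u u.
Proof. by rewrite sqr_sqrtr ?dot_ge0. Qed.

Lemma enorm0 : enorm (0 : 'rV[R]_n) = 0.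
Proof. by rewrite /enorm dot0l sqrtr0. Qed.

Lemma enormN u : enorm (- u) = enorm u.
Proof. by rewrite /enorm dotNl dotNr opprK. Qed.

Lemma enormB u v : enorm (u - v) = enorm (v - u).
Proof. by rewrite -enormN opprB. Qed.

Lemma enormZ a u : enorm (a *: u) = `|a| * enorm u.
Proof.
by rewrite /enorm dotZl dotZr mulrA -expr2 sqrtrM ?sqr_ge0// sqrtr_sqr.
Qed.

Lemma enorm_unit v : dot v v = 1 -> enorm v = 1.
Proof. by rewrite /enorm => ->; rewrite sqrtr1. Qed.

Lemma enorm_le a u : 0 <= a -> (enorm u <= a) = (dot u u <= a ^+ 2).
Proof.
by move=> a0; rewrite -sqr_enorm ler_sqr// nnegrE enorm_ge0.
Qed.

Lemma cauchy_schwarz u v : dot u v ^+ 2 <= dot u u * dot v v.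
Proof.
have [/dot_eq0 ->|v0] := eqVneq (dot v v) 0.
  by rewrite dotC !dot0l expr0n mulr0.
have vp : 0 < dot v v by rewrite lt_def v0 dot_ge0.
have := dot_ge0 (dot v v *: u - dot u v *: v).
rewrite !dotE (dotC v u) => h.
rewrite -subr_ge0 -(pmulr_rge0 _ vp); apply: le_trans h _.
by rewrite le_eqVlt; apply/orP; left; apply/eqP; ring.
Qed.

Lemma ler_dot u v : `|dot u v| <= enorm u * enorm v.
Proof.
rewrite -ler_sqr ?nnegrE ?mulr_ge0 ?enorm_ge0// exprMn !sqr_enorm.
by rewrite real_normK ?num_real// cauchy_schwarz.
Qed.

Lemma ler_dot_unit v u : dot v v = 1 -> `|dot u v| <= enorm u.
Proof. by move=> v1; rewrite (le_trans (ler_dot _ _))// (enorm_unit v1) mulr1. Qed.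

Lemma ler_enormD u v : enorm (u + v) <= enorm u + enorm v.
Proof.
rewrite -ler_sqr ?nnegrE ?addr_ge0 ?enorm_ge0// sqr_enorm.
rewrite sqrrD !sqr_enorm !dotE (dotC v u) -addrA.
have := le_trans (ler_norm _) (ler_dot u v).
lra.
Qed.

Lemma ler_enormB u v : enorm (u - v) <= enorm u + enorm v.
Proof. by rewrite -(enormN v) ler_enormD. Qed.

Lemma enorm_triangle z x y : enorm (x - y) <= enorm (x - z) + enorm (z - y).
Proof. by rewrite (le_trans _ (ler_enormD _ _))// addrA subrK. Qed.

Lemma ler_coord u i : `|u 0 i| <= enorm u.
Proof.
rewrite -ler_sqr ?nnegrE ?enorm_ge0// sqr_enorm real_normK ?num_real//.
rewrite /dot (bigD1 i)//= -expr2 lerDl sumr_ge0// => j _.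
by rewrite -expr2 sqr_ge0.
Qed.

Lemma enorm_le_sup u a : 0 <= a -> (forall i, `|u 0 i| <= a) ->
  enorm u <= n%:R * a.
Proof.
move=> a0 ua; rewrite enorm_le ?mulr_ge0 ?ler0n//.
apply: (@le_trans _ _ (\sum_(i < n) a ^+ 2)).
  apply: ler_sum => i _; rewrite -expr2 -[_ ^+ 2]real_normK ?num_real//.
  by rewrite ler_sqr ?nnegrE.
rewrite sumr_const card_ord -[leLHS]mulr_natl exprMn.
apply: ler_wpM2r; first exact: sqr_ge0.
by rewrite -natrX ler_nat; case: (n) => // k; rewrite leq_pmulr.
Qed.

(** The topology of ['rV_n] comes from the sup norm; this is the bridge to the
    Euclidean balls in which everything else is phrased. *)
Lemma nbhs_enorm x (P : set 'rV[R]_n) :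
  nbhs x P <-> exists2 d, 0 < d & forall y, enorm (y - x) <= d -> P y.
Proof.
split.
  move=> /nbhs_ballP[e /= e0 eP]; exists (e / 2); first by rewrite divr_gt0.
  move=> y yx; apply: eP; rewrite /ball /= /mx_ball; split=> // i j.
  rewrite (ord1 i) /ball /= -opprB normrN.
  have := le_trans (ler_coord (y - x) j) yx; rewrite !mxE => h.
  by rewrite (le_lt_trans h)// ltr_pdivrMr// ltr_pMr// ltr1n.
move=> [d d0 dP]; apply/nbhs_ballP; exists (d / n.+1%:R) => /=.
  by rewrite divr_gt0.
move=> y; rewrite /ball /= /mx_ball => -[_ xy]; apply: dP.
have h i : `|(y - x) 0 i| <= d / n.+1%:R.
  by have := xy 0 i; rewrite /ball/= -opprB normrN !mxE => /ltW.
apply: (le_trans (enorm_le_sup _ h)); first by rewrite divr_ge0 ?ltW.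
by rewrite mulrCA ler_piMr ?(ltW d0)// ler_pdivrMr// mul1r ler_nat.
Qed.

End euclidean.

Section space.
Context (R : realType).
Implicit Types (u v w x y : 'rV[R]_3) (a b c : R).

Definition vec3 a b c : 'rV[R]_3 := \row_i nth 0 [:: a; b; c] i.

Lemma dot3 u v :
  dot u v = u 0 0 * v 0 0 + u 0 1 * v 0 1 + u 0 (2%:R) * v 0 (2%:R).
Proof.
rewrite /dot !big_ord_recl big_ord0 addr0 addrA.
by congr (_ + _ + _); congr (u _ _ * v _ _); apply/val_inj.
Qed.

Lemma vec3E a b c :
  (vec3 a b c 0 0 = a) * (vec3 a b c 0 1 = b) * (vec3 a b c 0 2%:R = c).
Proof. by rewrite !mxE. Qed.

Lemma det3 (A : 'M[R]_3) : \det A =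
  A 0 0 * (A 1 1 * A 2%:R 2%:R - A 1 2%:R * A 2%:R 1) +
  A 0 1 * (A 1 2%:R * A 2%:R 0 - A 1 0 * A 2%:R 2%:R) +
  A 0 2%:R * (A 1 0 * A 2%:R 1 - A 1 1 * A 2%:R 0).
Proof.
pose f (i j : nat) := A (inord i) (inord j).
have Af i j : A i j = f i j by rewrite /f !inord_val.
rewrite (expand_det_row _ 0) !big_ord_recl big_ord0 /cofactor.
rewrite !(expand_det_row _ 0) !big_ord_recl !big_ord0 /cofactor !det_mx11 !mxE.
rewrite !Af /= /bump /= !addn0 !expr0 !expr1 !mulN1r.
ring.
Qed.

End space.

(** * Tetrahedra and the Menger kernel *)

Section cross_product.
Context (R : realType).
Implicit Types (u v w x y : 'rV[R]_3) (a b c : 'rV[R]_3).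

Definition cross a b : 'rV[R]_3 :=
  vec3 (a 0 1 * b 0 2%:R - a 0 2%:R * b 0 1)
       (a 0 2%:R * b 0 0 - a 0 0 * b 0 2%:R)
       (a 0 0 * b 0 1 - a 0 1 * b 0 0).

Definition triple a b c : R := dot a (cross b c).

Lemma dot_cross a b :
  dot (cross a b) (cross a b) = dot a a * dot b b - dot a b ^+ 2.
Proof. by rewrite !dot3 /cross !vec3E; ring. Qed.

Lemma enorm_cross a b : enorm (cross a b) <= enorm a * enorm b.
Proof.
rewrite enorm_le ?mulr_ge0 ?enorm_ge0// exprMn !sqr_enorm dot_cross.
by rewrite gerBl sqr_ge0.
Qed.

Lemma dot_cross_l a b : dot a (cross a b) = 0.
Proof. by rewrite dot3 /cross !vec3E; ring. Qed.

Lemma dot_cross_r a b : dot b (cross a b) = 0.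
Proof. by rewrite dot3 /cross !vec3E; ring. Qed.

Lemma ler_triple a b c : `|triple a b c| <= enorm a * (enorm b * enorm c).
Proof.
rewrite (le_trans (ler_dot _ _))// ler_wpM2l ?enorm_ge0//.
exact: enorm_cross.
Qed.

Lemma triple_diff a b c a' b' c' : triple a' b' c' - triple a b c =
  triple (a' - a) b' c' + triple a (b' - b) c' + triple a b (c' - c).
Proof. by rewrite /triple !dot3 /cross !vec3E !mxE; ring. Qed.

Lemma normalized w : w != 0 ->
  dot ((enorm w)^-1 *: w) ((enorm w)^-1 *: w) = 1.
Proof.
move=> w0; have n0 : dot w w != 0 by apply: contra_neq w0 => /dot_eq0.
by rewrite dotZl dotZr mulrA -expr2 exprVn sqr_enorm mulVf.
Qed.

Lemma enorm_gt0 w : (0 < enorm w) = (w != 0).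
Proof.
rewrite lt_def enorm_ge0 andbT; congr negb; apply/eqP/eqP => [w0|->].
  by apply: dot_eq0; rewrite -sqr_enorm w0 expr0n.
exact: enorm0.
Qed.

Lemma unit_neq0 v : dot v v = 1 -> v != 0.
Proof. by apply: contra_eq_neq => ->; rewrite dot0l eq_sym oner_eq0. Qed.

Lemma orthonormal_frame v : dot v v = 1 -> exists e1 e2 : 'rV[R]_3,
  [/\ dot e1 e1 = 1, dot e2 e2 = 1, dot e1 e2 = 0, dot e1 v = 0 & dot e2 v = 0].
Proof.
move=> v1.
have [e [e1 ev]] : exists e : 'rV[R]_3, dot e e = 1 /\ dot e v = 0.
  pose w := vec3 (- v 0 1) (v 0 0) 0.
  have wv : dot w v = 0 by rewrite dot3 /w !vec3E; ring.
  have [w0|w0] := eqVneq w 0.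
    exists (vec3 1 0 0); split; first by rewrite dot3 !vec3E; ring.
    have : w 0 1 = 0 by rewrite w0 mxE.
    by rewrite dot3 !vec3E => ->; ring.
  exists ((enorm w)^-1 *: w); split; first exact: normalized.
  by rewrite dotZl wv mulr0.
exists e, (cross e v); split => //.
- by rewrite dot_cross e1 v1 ev; ring.
- exact: dot_cross_l.
- by rewrite dotC dot_cross_r.
Qed.

(** If [D] escapes every slab of half-width [h] around a plane through [x], then
    three points of [D] span with [x] a large volume.  They are chosen greedily,
    each one far from the span of the previous ones: the normals used are a
    coordinate vector, then a vector orthogonal to the first edge [a] in the
    plane of the first two coordinates, then the cross product of the first two
    edges. *)
Lemma wide_triple (D : set 'rV[R]_3) x (h : R) : 0 < h ->
  (forall v, dot v v = 1 -> exists2 y, D y & h < `|dot (y - x) v|) ->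
  exists y1 y2 y3, [/\ D y1, D y2, D y3 &
    h ^+ 3 <= `|triple (y1 - x) (y2 - x) (y3 - x)|].
Proof.
move=> h0 wide.
have {}wide w : w != 0 -> exists2 y, D y & h * enorm w < `|dot (y - x) w|.
  move=> w0; have [y Dy hy] := wide _ (normalized w0); exists y => //.
  move: hy; rewrite dotZr normrM ger0_norm ?invr_ge0 ?enorm_ge0//.
  by rewrite mulrC ltr_pdivlMr ?enorm_gt0.
have [|y2 Dy2] := wide (vec3 1 0 0).
  by apply: unit_neq0; rewrite dot3 !vec3E; ring.
rewrite enorm_unit ?dot3 ?vec3E; last by ring.
rewrite !mulr0 !addr0 !mulr1; set a := y2 - x => ha.
pose w := vec3 (- a 0 1) (a 0 0) 0.
have hw : h <= enorm w.
  by rewrite (le_trans (ltW ha))// (le_trans _ (ler_coord w 1))// vec3E.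
have [|y3 Dy3] := wide w; first by rewrite -enorm_gt0 (lt_le_trans h0).
set b := y3 - x => hb.
(* [dot b w] is the third coordinate of [cross a b]. *)
have hc : h ^+ 2 <= enorm (cross a b).
  apply: le_trans (ler_coord _ 2%:R); rewrite vec3E.
  have -> : a 0 0 * b 0 1 - a 0 1 * b 0 0 = dot b w.
    by rewrite dot3 !vec3E; ring.
  by apply: le_trans (ltW hb); rewrite expr2 ler_wpM2l ?(ltW h0).
have [|y1 Dy1 h1] := wide (cross a b).
  by rewrite -enorm_gt0 (lt_le_trans _ hc)// exprn_gt0.
exists y1, y2, y3; split=> //; apply: le_trans (ltW h1).
by rewrite exprS ler_wpM2l ?(ltW h0).
Qed.

(** Multilinearity: replacing the three edges one after the other costs at most
    [4 + 2 + 1 = 7] times [d * r ^+ 3], the new edges having length at most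
    [2 * r]. *)
Lemma triple_perturb (r d : R) a b c a' b' c' : 0 <= r -> 0 <= d <= 1 ->
  enorm a <= r -> enorm b <= r -> enorm c <= r ->
  enorm (a' - a) <= d * r -> enorm (b' - b) <= d * r -> enorm (c' - c) <= d * r ->
  `|triple a b c| - 7 * d * r ^+ 3 <= `|triple a' b' c'|.
Proof.
move=> r0 /andP[d0 d1] ar br cr aa bb cc.
have h w w' : enorm w <= r -> enorm (w' - w) <= d * r -> enorm w' <= 2 * r.
  move=> wr ww; rewrite -(subrK w w') (le_trans (ler_enormD _ _))//.
  by rewrite mulr2n mulrDl mul1r lerD// (le_trans ww)// ler_piMl.
have br' := h _ _ br bb; have cr' := h _ _ cr cc.
have e0 := @enorm_ge0 R 3.
have dr0 : 0 <= d * r by rewrite mulr_ge0.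
have t1 : `|triple (a' - a) b' c'| <= (d * r) * ((2 * r) * (2 * r)).
  by rewrite (le_trans (ler_triple _ _ _))// !ler_pM ?mulr_ge0.
have t2 : `|triple a (b' - b) c'| <= r * ((d * r) * (2 * r)).
  by rewrite (le_trans (ler_triple _ _ _))// !ler_pM ?mulr_ge0.
have t3 : `|triple a b (c' - c)| <= r * (r * (d * r)).
  by rewrite (le_trans (ler_triple _ _ _))// !ler_pM ?mulr_ge0.
have : `|triple a' b' c' - triple a b c| <= 7 * d * r ^+ 3.
  rewrite triple_diff (le_trans (ler_normD _ _))//.
  apply: (le_trans (lerD (le_trans (ler_normD _ _) (lerD t1 t2)) t3)).
  by rewrite le_eqVlt; apply/orP; left; apply/eqP; ring.
rewrite distrC => /(le_trans (lerB_dist _ _)); lra.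
Qed.


End cross_product.

Section kernel_bound.
Context (R : realType).
Implicit Types (T : 'I_4 -> 'rV[R]_3).

Lemma triple_rot (a b c : 'rV[R]_3) : triple a b c = triple c a b.
Proof. by rewrite /triple !dot3 /cross !vec3E; ring. Qed.

Lemma tetra_volumeE T : tetra_volume T =
  `|triple (T 1 - T 0) (T 2%:R - T 0) (T 3%:R - T 0)| / 6.
Proof.
rewrite /tetra_volume det3 /triple dot3 /cross !vec3E.
rewrite ![(\matrix_(i < 3) _) _ _]mxE.
have -> : lift ord0 0 = 1 :> 'I_4 by apply/val_inj.
have -> : lift ord0 1 = 2%:R :> 'I_4 by apply/val_inj.
have -> : lift ord0 2%:R = 3%:R :> 'I_4 by apply/val_inj.
by congr (`| _ | / _); ring.
Qed.

Lemma coplanar_volume T : coplanar T -> tetra_volume T = 0.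
Proof.
move=> [nu [c [nu0 Tc]]]; apply/eqP; rewrite mulf_eq0 normr_eq0.
apply/orP; left; rewrite -det_tr; apply/det0P; exists nu => //.
apply/rowP => i; rewrite [RHS]mxE.
have <- : dot nu (T (lift ord0 i) - T ord0) = 0 by rewrite dotBr !Tc subrr.
rewrite mxE; apply: eq_bigr => j _.
by rewrite !mxE.
Qed.

Lemma triangle_area_le n (a b c : 'rV[R]_n) d : 0 <= d ->
  enorm (b - a) <= d -> enorm (c - a) <= d -> triangle_area a b c <= d ^+ 2 / 2.
Proof.
move=> d0 ab ac; rewrite /triangle_area ler_pM2r ?invr_gt0//.
rewrite -(@ger0_norm _ (d ^+ 2)) ?sqr_ge0// -sqrtr_sqr ler_sqrt ?sqr_ge0//.
apply: (@le_trans _ _ (dot (b - a) (b - a) * dot (c - a) (c - a))).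
  by rewrite gerBl sqr_ge0.
by rewrite expr2 ler_pM ?dot_ge0// -enorm_le.
Qed.

Lemma triangle_area_ge0 n (a b c : 'rV[R]_n) : 0 <= triangle_area a b c.
Proof. by rewrite divr_ge0// sqrtr_ge0. Qed.

Lemma tetra_area_le T d : 0 <= d -> (forall i j, enorm (T i - T j) <= d) ->
  tetra_area T <= 2 * d ^+ 2.
Proof.
move=> d0 Td; apply: (@le_trans _ _ (\sum_(i < 4) d ^+ 2 / 2)).
  by apply: ler_sum => i _; apply: triangle_area_le.
by rewrite sumr_const card_ord -mulr_natl; lra.
Qed.

Lemma tetra_area_gt0 T : 0 < tetra_volume T -> 0 < tetra_area T.
Proof.
move=> V0; rewrite /tetra_area (bigD1 ord_max)//=.
apply: ltr_wpDr; first by apply: sumr_ge0 => i _; exact: triangle_area_ge0.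
have -> : lift ord_max (inord 0) = 0 :> 'I_4 by apply/val_inj; rewrite /= inordK.
have -> : lift ord_max (inord 1) = 1 :> 'I_4 by apply/val_inj; rewrite /= inordK.
have -> : lift ord_max (inord 2) = 2%:R :> 'I_4 by apply/val_inj; rewrite /= inordK.
rewrite /triangle_area divr_gt0// sqrtr_gt0 -dot_cross -sqr_enorm exprn_gt0//.
rewrite enorm_gt0; apply: contraTneq V0 => C0.
by rewrite tetra_volumeE triple_rot /triple C0 dotC dot0l normr0 mul0r ltxx.
Qed.

Lemma tetra_diam_le T d : 0 <= d -> (forall i j, enorm (T i - T j) <= d) ->
  tetra_diam T <= d.
Proof.
move=> d0 Td; rewrite /tetra_diam.
by apply: bigmax_le => // i _; apply: bigmax_le => // j _; exact: Td.
Qed.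

Lemma tetra_diam_gt0 T : 0 < tetra_volume T -> 0 < tetra_diam T.
Proof.
move=> V0; apply: (@lt_le_trans _ _ (enorm (T 1 - T 0))).
  rewrite enorm_gt0; apply: contraTneq V0 => T10.
  by rewrite tetra_volumeE T10 /triple dot0l normr0 mul0r ltxx.
apply: le_trans (le_bigmax _ _ (1 : 'I_4)).
exact: (le_bigmax _ (fun j => enorm (T 1 - T j)) (0 : 'I_4)).
Qed.

(** In a tetrahedron of diameter at most [d] the denominator of the kernel is at
    most [2 * d ^+ 2 * d ^+ 2], so only the volume has to be bounded below; a
    positive volume also excludes the degenerate cases, in which the quotient
    would be zero. *)
Lemma menger_kernel_ge T d t : 0 < t -> 0 < d ->
  (forall i j, enorm (T i - T j) <= d) -> t <= 6 * tetra_volume T ->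
  t / (12 * d ^+ 4) <= menger_kernel T.
Proof.
move=> t0 d0 Td tV; have V0 : 0 < tetra_volume T by lra.
rewrite /menger_kernel; case: asboolP => [/coplanar_volume VT|_].
  by rewrite VT ltxx in V0.
have A0 := tetra_area_gt0 V0; have D0 := tetra_diam_gt0 V0.
have Al := tetra_area_le (ltW d0) Td; have Dl := tetra_diam_le (ltW d0) Td.
rewrite ler_pdivrMr ?mulr_gt0 ?exprn_gt0// mulrAC ler_pdivlMr ?mulr_gt0 ?exprn_gt0//.
apply: (@le_trans _ _ (6 * tetra_volume T * (2 * d ^+ 2 * d ^+ 2))); last first.
  by rewrite le_eqVlt; apply/orP; left; apply/eqP; ring.
apply: ler_pM => //; rewrite ?mulr_ge0 ?exprn_ge0// ?(ltW A0) ?(ltW t0) ?(ltW D0)//.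
apply: ler_pM => //; rewrite ?mulr_ge0 ?exprn_ge0// ?(ltW A0) ?(ltW D0)//.
by rewrite ler_sqr// nnegrE ltW.
Qed.

Lemma menger_kernel_ge0 T : 0 <= menger_kernel T.
Proof.
rewrite /menger_kernel; case: asboolP => // _.
rewrite divr_ge0// ?divr_ge0// mulr_ge0 ?sqr_ge0//.
by apply: sumr_ge0 => i _; exact: triangle_area_ge0.
Qed.

End kernel_bound.

(** * Hausdorff measure and the energy integral *)

Section hausdorff_metric_measure.
Context (R : realType) (n : nat).
Implicit Types (A B F X : set 'rV[R]_n).
Local Open Scope ereal_scope.

Lemma enorm_le_ediam A x y : A x -> A y -> (enorm (x - y))%:E <= ediam A.
Proof. by move=> Ax Ay; apply: ereal_sup_ubound; right; exists (x, y). Qed.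

Let area A : \bar R := (pi / 4)%:E * ediam A ^+ 2.

Let area_ge0 A : 0 <= area A.
Proof.
rewrite /area expe2 mule_ge0 ?mule_ge0 ?ediam_ge0//.
by rewrite lee_fin divr_ge0// pi_ge0.
Qed.

Let area0 : area set0 = 0.
Proof. by rewrite /area ediam0 expe2 mul0e mule0. Qed.

Lemma hausdorff2_delta_antitone A (d e : R) : (d <= e)%R ->
  hausdorff2_delta e A <= hausdorff2_delta d A.
Proof.
move=> de; apply/ereal_inf_le_tmp => _ [C [AC Cd] <-]; exists C => //.
by split => // k; rewrite (le_trans (Cd k))// lee_fin.
Qed.

Lemma hausdorff2_delta_le A (d : R) : (0 < d)%R ->
  hausdorff2_delta d A <= hausdorff2 A.
Proof. by move=> d0; apply: ereal_sup_ubound; exists d. Qed.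

(** A set of diameter at most [d < e] meets at most one of two sets at distance
    [e], so every fine cover of the union splits into covers of the parts. *)
Lemma hausdorff2_delta_far A B (d e : R) : (d < e)%R ->
  (forall a b, A a -> B b -> (e <= enorm (a - b))%R) ->
  hausdorff2_delta d A + hausdorff2_delta d B <= hausdorff2_delta d (A `|` B).
Proof.
move=> de far; apply: le_ereal_inf_tmp => _ [C [ABC Cd] <-].
pose CI X k := if `[< C k `&` X !=set0 >] then C k else set0.
have CIP X : X `<=` A `|` B -> hausdorff2_delta d X <= \sum_(k <oo) area (CI X k).
  move=> XAB; apply: ereal_inf_lbound; exists (CI X) => //; split.
    move=> x Xx; have [k _ Ckx] := ABC _ (XAB _ Xx); exists k => //.
    by rewrite /CI asboolT//; exists x.
  move=> k; rewrite /CI; case: asboolP => // _.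
  by rewrite ediam0 (le_trans (ediam_ge0 (C k))).
apply: (le_trans (leeD (CIP A _) (CIP B _))) => [x|x|]; [by left|by right|].
rewrite -nneseriesD; [|by move=> *; exact: area_ge0..].
apply: lee_nneseries => [k _ _|k _]; first by rewrite adde_ge0.
rewrite /CI; case: asboolP => [[a [Ca Aa]]|_]; last first.
  by rewrite area0 add0e; case: asboolP => // _; rewrite area0 area_ge0.
case: asboolP => [[b [Cb Bb]]|_]; last by rewrite area0 adde0.
have := le_trans (enorm_le_ediam Ca Cb) (Cd k); rewrite lee_fin => abd.
by have := lt_le_trans de (le_trans (far _ _ Aa Bb) abd); rewrite ltxx.
Qed.

Lemma hausdorff2_far A B (e : R) : (0 < e)%R ->
  (forall a b, A a -> B b -> (e <= enorm (a - b))%R) ->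
  hausdorff2 A + hausdorff2 B <= hausdorff2 (A `|` B).
Proof.
move=> e0 far; have [->|foo] := eqVneq (hausdorff2 (A `|` B)) +oo.
  by rewrite leey.
have fin X : X `<=` A `|` B -> hausdorff2 X \is a fin_num.
  move=> XAB; rewrite ge0_fin_numE ?hausdorff2_ge0//.
  by rewrite (le_lt_trans (le_hausdorff2 XAB))// ltey.
have finA : hausdorff2 A \is a fin_num by apply: fin => x; left.
have key (d1 d2 : R) : (0 < d1)%R -> (0 < d2)%R ->
    hausdorff2_delta d1 A + hausdorff2_delta d2 B <= hausdorff2 (A `|` B).
  move=> d10 d20; pose d := Num.min (Num.min d1 d2) (e / 2)%R.
  have d0 : (0 < d)%R by rewrite !lt_min d10 d20 divr_gt0.
  have de : (d < e)%R by rewrite gt_min orbC gtr_pMr// invf_lt1// ltr1n.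
  have dd1 : (d <= d1)%R by rewrite !ge_min lexx.
  have dd2 : (d <= d2)%R by rewrite !ge_min lexx orbT.
  apply: le_trans (hausdorff2_delta_le _ d0).
  apply: le_trans (hausdorff2_delta_far de far).
  by rewrite leeD// hausdorff2_delta_antitone.
rewrite -leeBrDl//; apply: ge_ereal_sup => _ [d2 /= d20 <-].
rewrite leeBrDl// -leeBrDr; last first.
  rewrite ge0_fin_numE ?hausdorff2_delta_ge0//.
  rewrite (le_lt_trans (hausdorff2_delta_le _ d20))//.
  by rewrite -ge0_fin_numE ?hausdorff2_ge0// fin// => x; right.
apply: ge_ereal_sup => _ [d1 /= d10 <-].
rewrite leeBrDr ?key// ge0_fin_numE ?hausdorff2_delta_ge0//.
rewrite (le_lt_trans (hausdorff2_delta_le _ d20))//.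
by rewrite -ge0_fin_numE ?hausdorff2_ge0// fin// => x; right.
Qed.

(** Caratheodory's criterion.  The parts [A k] of [X] at distance at least
    [k.+1%:R^-1] from [F] add up with [X `&` F] by [hausdorff2_far], and they
    exhaust [X] outside [F]; the point is that [hausdorff2 (A k)] converges to
    [hausdorff2 (X `&` ~` F)].  This holds because the layers [D k] between
    consecutive [A k] have summable measure: [A k] and [D k.+1] are again at
    positive distance. *)
Lemma closed_caratheodory F : closed F ->
  caratheodory_measurable (@hausdorff2 R n) F.
Proof.
move=> cF; apply: le_caratheodory_measurable => X /=.
have [->|Xoo] := eqVneq (hausdorff2 X) +oo; first by rewrite leey.
have HX : hausdorff2 X < +oo by rewrite ltey.
have inv_gt0 k : (0 < k.+1%:R^-1 :> R)%R by rewrite invr_gt0.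
pose A k := [set a | X a /\ forall f, F f -> (k.+1%:R^-1 <= enorm (a - f))%R].
pose D k := A k.+1 `\` A k.
have AX k : A k `<=` X by move=> a [].
have AH i j : (i <= j)%N -> A i `<=` A j.
  move=> ij a [Xa aF]; split => // f /aF; apply: le_trans.
  by rewrite lef_pV2 ?posrE// ler_nat.
have farA k : hausdorff2 (X `&` F) + hausdorff2 (A k) <= hausdorff2 X.
  apply: (@le_trans _ _ (hausdorff2 ((X `&` F) `|` A k))).
    apply: (@hausdorff2_far _ _ k.+1%:R^-1) => // a b [Xa Fa] [_ bF].
    by rewrite enormB bF.
  by apply: le_hausdorff2 => x [[]|/AX].
have farD k : hausdorff2 (A k) + hausdorff2 (D k.+1) <= hausdorff2 (A k.+2).
  apply: (@le_trans _ _ (hausdorff2 (A k `|` D k.+1))); last first.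
    by apply: le_hausdorff2 => x [|[//]]; apply: AH; rewrite leqW.
  apply: (@hausdorff2_far _ _ (k.+1%:R^-1 - k.+2%:R^-1)%R).
    by rewrite subr_gt0 ltf_pV2 ?posrE// ltr_nat.
  move=> a b [Xa aF] [[Xb _] nb].
  have [f Ff bf] : exists2 f, F f & (enorm (b - f) < k.+2%:R^-1)%R.
    apply: contrapT => h; apply: nb; split => // f Ff.
    by rewrite leNgt; apply/negP => bf; apply: h; exists f.
  rewrite lerBlDr (le_trans (aF f Ff))//.
  by rewrite (le_trans (enorm_triangle b _ _))// lerD// ltW.
have sumD N : \sum_(0 <= k < N.+1) hausdorff2 (D k) <=
    hausdorff2 (A N) + hausdorff2 (A N.+1).
  elim: N => [|N IH].
    rewrite big_nat1 (le_trans (le_hausdorff2 (_ : _ `<=` A 1%N)))//.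
      by move=> x [].
    by rewrite leeDr ?hausdorff2_ge0.
  rewrite big_nat_recr//= addeC; apply: (le_trans (leeD (lexx _) IH)).
  by rewrite addeA addeC leeD2l// addeC.
have finX : hausdorff2 X \is a fin_num by rewrite ge0_fin_numE ?hausdorff2_ge0.
have sumD_fin : \sum_(0 <= k <oo) hausdorff2 (D k) < +oo.
  apply: (@le_lt_trans _ _ (hausdorff2 X + hausdorff2 X)); last first.
    by rewrite lte_add_pinfty.
  apply: lime_le; first by apply: is_cvg_nneseries => *; exact: hausdorff2_ge0.
  apply: nearW => -[|N]; first by rewrite big_geq// adde_ge0// hausdorff2_ge0.
  by rewrite (le_trans (sumD N))// leeD// le_hausdorff2.
have AFU N : X `&` ~` F `<=` A N `|` \bigcup_(k in ~` `I_N) D k.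
  move=> x [Xx nFx].
  have [m Am] : exists m, A m x.
    have : nbhs x (~` F) by apply: open_nbhs_nbhs; split => //; exact: closed_openC.
    move=> /nbhs_enorm[d d0 dF]; exists (Num.truncn (d^-1)); split => // f Ff.
    rewrite leNgt; apply/negP => xf; apply: (dF f) => //.
    rewrite enormB (le_trans (ltW xf))// invf_ple ?posrE//.
    by rewrite ltW// real_truncnS_gt// num_real.
  elim: m Am => [|m IH] Am; first by left; apply: AH Am.
  have [/IH//|nAm] := pselect (A m x).
  have [mN|Nm] := ltnP m N; first by left; apply: AH Am.
  by right; exists m => //=; apply/negP; rewrite -leqNgt.
have tail N : hausdorff2 (X `&` F) + hausdorff2 (X `&` ~` F) <=
    hausdorff2 X + \sum_(N <= k <oo) hausdorff2 (D k).
  have : hausdorff2 (X `&` ~` F) <=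
      hausdorff2 (A N) + \sum_(N <= k <oo) hausdorff2 (D k).
    apply: (le_trans (le_hausdorff2 (AFU N))).
    apply: (le_trans (outer_measureU2 (@hausdorff2 R n) _ _)).
    by rewrite leeD2l//; exact: outer_measure_sigma_subadditive_tail.
  move=> h; apply: (le_trans (leeD (lexx _) h)).
  by rewrite addeA leeD2r.
have cvgX : (hausdorff2 X + \sum_(N <= k <oo) hausdorff2 (D k)) @[N --> \oo]
    --> hausdorff2 X + 0.
  apply: cvgeD; first by rewrite fin_num_adde_defl.
    exact: cvg_cst.
  by apply: nneseries_tail_cvg => // k _; exact: hausdorff2_ge0.
rewrite adde0 in cvgX.
rewrite -(cvg_lim _ cvgX)//; apply: lime_ge.
  by apply/cvg_ex; exists (hausdorff2 X).
exact: nearW.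
Qed.

End hausdorff_metric_measure.

Section integral_lower_bound.
Context (R : realType).
Local Open Scope ereal_scope.

(** A nonnegative constant on a measurable set is one of the simple functions
    below [f] over which the integral takes the supremum. *)
Lemma integral_ge_const d (T : measurableType d) (mu : {measure set T -> \bar R})
    (D B : set T) (f : T -> \bar R) (c m : R) :
  measurable B -> B `<=` D -> (forall x, D x -> 0 <= f x) ->
  (forall x, B x -> c%:E <= f x) -> (0 <= c)%R -> m%:E <= mu B ->
  (c * m)%:E <= \int[mu]_(x in D) f x.
Proof.
move=> mB BD f0 cf c0 mmu.
apply: (@le_trans _ _ (\int[mu]_(x in B) (cst c%:E) x)).
  by rewrite integral_cst// EFinM lee_wpmul2l// lee_fin.
rewrite !ge0_integralE//.
apply: ge_ereal_sup => _ [h hc <-]; apply: ereal_sup_ubound; exists h => // x.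
apply: (le_trans (hc x)); rewrite /patch; case: ifPn => [xB|_].
  by rewrite ifT ?cf ?inE//; [exact: set_mem|apply: BD; exact: set_mem].
by case: ifPn => // xD; apply: f0; exact: set_mem.
Qed.

Lemma closed_ecball n (x : 'rV[R]_n) (r : R) : closed (ecball x r).
Proof.
move=> y yx; rewrite /ecball /= leNgt; apply/negP => ry.
have d0 : (0 < (enorm (y - x) - r) / 2)%R by rewrite divr_gt0// subr_gt0.
have [|z [zx zy]] := yx [set z | (enorm (z - y) <= (enorm (y - x) - r) / 2)%R].
  by apply/nbhs_enorm; exists ((enorm (y - x) - r) / 2)%R.
have := enorm_triangle z y x; rewrite leNgt => /negP; apply.
rewrite enormB (le_lt_trans (lerD zy zx))//.
by move: ry; lra.
Qed.

Lemma H2_measurable (F : set 'rV[R]_3) : closed F ->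
  measurable (F : set (H2space R)).
Proof. exact: closed_caratheodory. Qed.

Lemma menger_curvature_ge (p k m : R) (Sigma B0 B1 B2 B3 : set 'rV[R]_3) :
  (0 <= p)%R -> (0 <= k)%R -> (0 <= m)%R ->
  closed B0 -> closed B1 -> closed B2 -> closed B3 ->
  B0 `<=` Sigma -> B1 `<=` Sigma -> B2 `<=` Sigma -> B3 `<=` Sigma ->
  m%:E <= hausdorff2 B0 -> m%:E <= hausdorff2 B1 ->
  m%:E <= hausdorff2 B2 -> m%:E <= hausdorff2 B3 ->
  (forall y0 y1 y2 y3, B0 y0 -> B1 y1 -> B2 y2 -> B3 y3 ->
    (k <= menger_kernel (tetra y0 y1 y2 y3))%R) ->
  (k `^ p * m ^+ 4)%:E <= menger_curvature p Sigma.
Proof.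
move=> p0 k0 m0 c0 c1 c2 c3 s0 s1 s2 s3 h0 h1 h2 h3 kle.
have kp0 : (0 <= k `^ p)%R by exact: powR_ge0.
rewrite /menger_curvature.
have -> : (k `^ p * m ^+ 4 = k `^ p * m * m * m * m)%R by ring.
apply: (@integral_ge_const _ _ _ _ (B3 : set (H2space R))) => //.
- exact: H2_measurable.
- by move=> x3 _; do 3! (apply: integral_ge0 => ? _); rewrite lee_fin powR_ge0.
- move=> y3 B3y; apply: (@integral_ge_const _ _ _ _ (B2 : set (H2space R))) => //.
  + exact: H2_measurable.
  + by move=> x2 _; do 2! (apply: integral_ge0 => ? _); rewrite lee_fin powR_ge0.
  + move=> y2 B2y; apply: (@integral_ge_const _ _ _ _ (B1 : set (H2space R))) => //.
    * exact: H2_measurable.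
    * by move=> x1 _; apply: integral_ge0 => ? _; rewrite lee_fin powR_ge0.
    * move=> y1 B1y; apply: (@integral_ge_const _ _ _ _ (B0 : set (H2space R))) => //.
      - exact: H2_measurable.
      - by move=> x0 _; rewrite lee_fin powR_ge0.
      - move=> y0 B0y; rewrite lee_fin ge0_ler_powR ?nnegrE//.
          exact: menger_kernel_ge0.
        exact: kle.
    * by rewrite mulr_ge0.
  + by rewrite !mulr_ge0.
- by rewrite !mulr_ge0.
Qed.

End integral_lower_bound.

(** * Areas of projections *)

Local Notation leb2 := ((@lebesgue_measure _ \x @lebesgue_measure _)%E).

Lemma leb2_rectangle (R : realType) (I J : interval R) :
  leb2 ([set` I] `*` [set` J]) =
  (lebesgue_measure [set` I] * lebesgue_measure [set` J])%E.
Proof. by rewrite product_measure1E//; exact: measurable_itv. Qed.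

Lemma leb2_setU (R : realType) (A B : set (R * R)) :
  measurable A -> measurable B -> A `&` B = set0 ->
  leb2 (A `|` B) = (leb2 A + leb2 B)%E.
Proof. by move=> mA mB AB; rewrite measureU. Qed.

Section projection.
Context (R : realType) (n : nat).
Implicit Types (A C : set 'rV[R]_n) (x e : 'rV[R]_n).
Local Open Scope ereal_scope.


Lemma projection_segment C x e (d : R) : C !=set0 -> dot e e = 1%R ->
  ediam C = d%:E -> exists a : R, forall y, C y -> (a <= dot (y - x) e <= a + d)%R.
Proof.
move=> [y0 Cy0] e1 Cd.
have far y z : C y -> C z -> (dot (y - x) e - d <= dot (z - x) e)%R.
  move=> Cy Cz; rewrite lerBlDr -lerBlDl -dotBl.
  have -> : (y - x - (z - x) = y - z)%R by rewrite opprB addrA subrK.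
  rewrite (le_trans (ler_norm _))// (le_trans (ler_dot_unit _ e1))//.
  by rewrite -lee_fin -Cd; exact: enorm_le_ediam.
pose I := [set dot (y - x) e | y in C].
exists (inf I) => y Cy; apply/andP; split.
  apply: ge_inf; last by exists y.
  by exists (dot (y0 - x) e - d)%R => _ [z Cz <-]; exact: far.
rewrite -lerBlDr; apply: lb_le_inf; first by exists (dot (y0 - x) e), y0.
by move=> _ [z Cz <-]; exact: far.
Qed.

(** A set of diameter [d] projects into a square of side [d].  Compared with the
    disc of diameter [d] of the isodiametric inequality this loses the factor
    [4 / pi], which [cross_shape] makes up for. *)
Lemma projection_rectangle C x e1 e2 : ediam C < +oo ->
  dot e1 e1 = 1%R -> dot e2 e2 = 1%R ->
  exists Q : set (R * R), [/\ measurable Q,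
    leb2 Q <= ediam C ^+ 2 &
    forall y, C y -> Q (dot (y - x) e1, dot (y - x) e2)].
Proof.
move=> Coo u1 u2.
have [d d0 dE] : exists2 d, (0 <= d)%R & ediam C = d%:E.
  exists (fine (ediam C)); first by rewrite fine_ge0 ?ediam_ge0.
  by rewrite fineK// ge0_fin_numE ?ediam_ge0.
have [C0|/set0P/negP/negPn/eqP C0] := pselect (C !=set0); last first.
  exists set0; split => //; last by rewrite C0.
  by rewrite measure0 expe2 mule_ge0 ?ediam_ge0.
have [a ha] := projection_segment x C0 u1 dE.
have [b hb] := projection_segment x C0 u2 dE.
exists (`[a, (a + d)%R] `*` `[b, (b + d)%R]); split.
- exact: measurableX.
- rewrite leb2_rectangle !lebesgue_measure_itv/= !lte_fin.
  rewrite !ltrDl dE; move: d0; rewrite le_eqVlt => /predU1P[<-|->].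
    by rewrite ltxx mul0e.
  by rewrite -!EFinB -!EFinM lee_fin (addrC a) (addrC b) !addrK.
- by move=> y Cy; split => /=; rewrite in_itv/= ?ha ?hb.
Qed.

Lemma hausdorff2_ge_projection A x e1 e2 (S : set (R * R)) :
  dot e1 e1 = 1%R -> dot e2 e2 = 1%R -> measurable S ->
  (forall s, S s ->
    exists2 y, A y & s = (dot (y - x) e1, dot (y - x) e2)) ->
  (pi / 4)%:E * leb2 S <= hausdorff2 A.
Proof.
move=> u1 u2 mS SA; apply: le_trans (hausdorff2_delta_le A (@ltr01 R)).
apply: le_ereal_inf_tmp => _ [C [AC C1] <-].
have Q_ k := projection_rectangle x (le_lt_trans (C1 k) (ltry _)) u1 u2.
have [Q hQ] := choice Q_.
have pi4 : (0 <= pi / 4 :> R)%R by rewrite divr_ge0// pi_ge0.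
rewrite nneseriesZl; last by move=> k _; rewrite expe2 mule_ge0 ?ediam_ge0.
apply: lee_wpmul2l; first by rewrite lee_fin.
apply: (@le_trans _ _ (\sum_(k <oo) leb2 (Q k))).
  apply: measure_sigma_subadditive => //; first by move=> k; case: (hQ k).
  by move=> s /SA[y /AC[k _ Ck] ->]; exists k => //; case: (hQ k) => _ _; exact.
by apply: lee_nneseries => k // _; case: (hQ k).
Qed.

End projection.

Section cross_area.
Context (R : realType).
Local Open Scope ereal_scope.

(** Two rectangles of sides [8 / 5 * r] and [r], crossed and cut into disjoint
    pieces.  Their union has area [11 / 5 * r ^+ 2] and lies in a disc of radius
    less than [r]; the square inscribed in the disc of radius [r] would have area
    [2 * r ^+ 2] only with its corners on the circle. *)
Definition cross_shape (r : R) : set (R * R) :=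
  `[(- (4 / 5 * r))%R, (4 / 5 * r)%R] `*` `[(- (r / 2))%R, (r / 2)%R] `|`
  (`[(- (r / 2))%R, (r / 2)%R] `*` `](r / 2)%R, (4 / 5 * r)%R] `|`
   `[(- (r / 2))%R, (r / 2)%R] `*` `[(- (4 / 5 * r))%R, (- (r / 2))%R[).

Lemma measurable_cross_shape r : measurable (cross_shape r).
Proof.
by do 2! (apply: measurableU => //; try exact: measurableX); exact: measurableX.
Qed.

Lemma cross_shape_disc r s : (0 < r)%R -> cross_shape r s ->
  (s.1 ^+ 2 + s.2 ^+ 2 <= 89 / 100 * r ^+ 2)%R.
Proof.
case: s => a b r0 /=.
have sq (c d : R) : (- c <= d <= c -> d ^+ 2 <= c ^+ 2)%R.
  rewrite -ler_norml => dc; rewrite -[(d ^+ 2)%R]real_normK ?num_real//.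
  by rewrite lerXn2r// nnegrE (le_trans _ dc).
have h1 :
  (- (4 / 5 * r) <= a <= 4 / 5 * r -> a ^+ 2 <= 16 / 25 * r ^+ 2)%R.
  by move=> /sq; nra.
have h2 :
  (- (4 / 5 * r) <= b <= 4 / 5 * r -> b ^+ 2 <= 16 / 25 * r ^+ 2)%R.
  by move=> /sq; nra.
have h3 : (- (r / 2) <= a <= r / 2 -> a ^+ 2 <= r ^+ 2 / 4)%R by move=> /sq; nra.
have h4 : (- (r / 2) <= b <= r / 2 -> b ^+ 2 <= r ^+ 2 / 4)%R by move=> /sq; nra.
rewrite /cross_shape /= !in_itv/=.
move=> [[/h1 ? /h4 ?]|[[/h3 ?] /andP[b1 b2]|[/h3 ? /andP[b1 b2]]]]; first by nra.
  by have /h2 : (- (4 / 5 * r) <= b <= 4 / 5 * r)%R; lra.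
by have /h2 : (- (4 / 5 * r) <= b <= 4 / 5 * r)%R; lra.
Qed.

Lemma cross_shape_area r : (0 < r)%R ->
  (2 * r ^+ 2)%:E <= leb2 (cross_shape r).
Proof.
move=> r0; rewrite leb2_setU; [|exact: measurableX|by apply: measurableU; exact: measurableX|]; last first.
  apply/seteqP; split => // -[a b] [] [_ /=]; rewrite !in_itv/= => /andP[b1 b2].
  by move=> [[_ /andP[b3 b4]]|[_ /andP[b3 b4]]]; lra.
rewrite leb2_setU; [|exact: measurableX|exact: measurableX|]; last first.
  apply/seteqP; split => // -[a b] [] [_ /=]; rewrite !in_itv/= => /andP[b1 b2].
  by move=> [_ /andP[b3 b4]]; lra.
rewrite !leb2_rectangle !lebesgue_measure_itv/= !lte_fin.
rewrite !ifT; [|lra..].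
by rewrite -!EFinB -!EFinM -!EFinD lee_fin; nra.
Qed.

End cross_area.

(** * Flatness and separation *)

Section separation.
Context (R : realType).
Implicit Types (U S : set 'rV[R]_3) (x y z a b v : 'rV[R]_3) (r c eta : R).

(** Otherwise the segment would split into its parts in [U] and outside the
    closure of [U], against the connectedness of [[0, 1]].  All separation
    arguments below rest on this. *)
Lemma segment_meets_frontier n (U : set 'rV[R]_n) (a b : 'rV[R]_n) :
  open U -> U a -> ~ U b ->
  exists2 t : R, 0 <= t <= 1 & frontier U (a + t *: (b - a)).
Proof.
move=> oU Ua nUb; apply: contrapT => noF.
pose f t : 'rV[R]_n := a + t *: (b - a).
have cf : continuous f.
  by move=> t; apply: cvgD; [exact: cvg_cst|apply: cvgZr_tmp; exact: cvg_id].
have f0 : f 0 = a by rewrite /f scale0r addr0.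
have f1 : f 1 = b by rewrite /f scale1r addrC subrK.
have cI : connected [set` `[0 : R, 1]].
  by apply/connected_intervalP; exact: interval_is_interval.
pose B := [set` `[0 : R, 1]] `&` f @^-1` U.
have B01 : B = [set` `[0 : R, 1]].
  apply: cI.
  - by exists 0; split; rewrite /= ?in_itv/= ?lexx ?ler01// f0.
  - by exists (f @^-1` U) => //; apply: open_comp => // t _; exact: cf.
  - exists (f @^-1` closure U).
      by apply: closed_comp; [move=> t _; exact: cf|exact: closed_closure].
    apply/seteqP; split=> t [t01 Ut]; split => //; first exact: subset_closure.
    apply: contrapT => nUt; apply: noF; exists t; first by have := t01; rewrite /= in_itv.
    by split => // /interior_subset.
have : B 1 by rewrite B01 /= in_itv/= ler01 lexx.
by case=> _; rewrite /= f1.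
Qed.

Lemma segment_stays (U : set 'rV[R]_3) (a b : 'rV[R]_3) : open U ->
  (forall t : R, 0 <= t <= 1 -> ~ frontier U (a + t *: (b - a))) -> U a -> U b.
Proof.
move=> oU noF Ua; apply: contrapT => nUb.
by have [t t01] := segment_meets_frontier oU Ua nUb; exact: noF.
Qed.

Lemma enorm_segment x (a b : 'rV[R]_3) (t r : R) : 0 <= t <= 1 ->
  enorm (a - x) <= r -> enorm (b - x) <= r -> enorm (a + t *: (b - a) - x) <= r.
Proof.
move=> /andP[t0 t1] ax bx; have t1' : 0 <= 1 - t by rewrite subr_ge0.
have -> : a + t *: (b - a) - x = (1 - t) *: (a - x) + t *: (b - x).
  by apply/rowP => i; rewrite !mxE; ring.
rewrite (le_trans (ler_enormD _ _))// !enormZ !ger0_norm//.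
apply: le_trans (lerD (ler_wpM2l t1' ax) (ler_wpM2l t0 bx)) _.
by rewrite -mulrDl subrK mul1r.
Qed.

Definition flat_at S x r eta := exists2 v : 'rV[R]_3, dot v v = 1 &
  forall y, S y -> enorm (y - x) <= r -> `|dot (y - x) v| <= eta * r.

(** A two-sided corkscrew condition: [U] and its complement both contain a ball
    of radius [c * r] inside the ball [ecball x r]. *)
Definition two_sided U x r c := exists u w : 'rV[R]_3,
  (forall y, enorm (y - u) <= c * r -> U y /\ enorm (y - x) <= r) /\
  (forall y, enorm (y - w) <= c * r -> ~ U y /\ enorm (y - x) <= r).

(** The invariant carried from scale to scale: outside a slab around a plane
    through [x], one half of the ball lies in [U] and the other half in its
    complement. *)
Definition split_at U x r eta := exists2 v : 'rV[R]_3, dot v v = 1 &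
  forall y, enorm (y - x) <= r ->
    (eta * r < dot (y - x) v -> U y) /\ (dot (y - x) v < - (eta * r) -> ~ U y).

Lemma flat_upper_side U x r eta v y z : open U ->
  (forall w, frontier U w -> enorm (w - x) <= r -> `|dot (w - x) v| <= eta * r) ->
  enorm (y - x) <= r -> enorm (z - x) <= r ->
  eta * r < dot (y - x) v -> eta * r < dot (z - x) v -> U y -> U z.
Proof.
move=> oU flat yx zx hy hz; apply: segment_stays => // t t01 Fw.
have wr := enorm_segment t01 yx zx; have [t0 t1] := andP t01.
have := le_trans (ler_norm _) (flat _ Fw wr).
have -> : y + t *: (z - y) - x = (1 - t) *: (y - x) + t *: (z - x).
  by apply/rowP => i; rewrite !mxE; ring.
rewrite dotDl !dotZl; apply/negP; rewrite -ltNge.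
set p := dot (y - x) v in hy *; set q := dot (z - x) v in hz *.
have [t2|t2] := leP t (1 / 2); nra.
Qed.

(** A ball of radius [c * r] with [eta < c] does not fit into the slab that
    contains the surface, hence sticks out on one side.  Each of the two sides
    is convex and free of the surface, hence inside [U] or disjoint from it; the
    corkscrew balls show that both cases occur. *)
Lemma split_of_flat U x r eta c : open U -> 0 < r -> 0 <= eta < c ->
  flat_at (frontier U) x r eta -> two_sided U x r c -> split_at U x r eta.
Proof.
move=> oU r0 /andP[eta0 etac] [v v1 flat] [u [w [uU wU]]].
have probe (P : set 'rV[R]_3) q :
    (forall y, enorm (y - q) <= c * r -> P y /\ enorm (y - x) <= r) ->
    exists y, [/\ P y, enorm (y - x) <= r & eta * r < `|dot (y - x) v|].
  move=> Pq; pose s : R := if 0 <= dot (q - x) v then 1 else - 1.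
  have s1 : `|s| = 1 by rewrite /s; case: ifPn; rewrite ?normrN1 ?normr1.
  exists (q + (s * (c * r)) *: v).
  have cr0 : eta * r < c * r by rewrite ltr_pM2r.
  have cr1 : 0 <= c * r by rewrite (le_trans _ (ltW cr0))// mulr_ge0// ltW.
  have [|Py yx] := Pq (q + (s * (c * r)) *: v).
    by rewrite addrC addKr enormZ (enorm_unit v1) mulr1 normrM s1 mul1r ger0_norm.
  split => //; rewrite (lt_le_trans cr0)//.
  have -> : q + (s * (c * r)) *: v - x = (q - x) + (s * (c * r)) *: v by rewrite addrAC.
  rewrite dotDl dotZl v1 mulr1 /s; case: ifPn => [h|].
    by rewrite (le_trans _ (ler_norm _))//; lra.
  by rewrite -ltNge => h; rewrite -normrN (le_trans _ (ler_norm _))//; lra.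
have [u' [Uu' u'x hu]] := probe _ _ uU.
have [w' [nUw' w'x hw]] := probe _ _ wU.
(* Orient the normal towards the point of [U]. *)
wlog hu0 : v v1 flat hu hw {probe} / eta * r < dot (u' - x) v.
  move=> hwlog; have [h|h] := leP 0 (dot (u' - x) v).
    by apply: (hwlog v) => //; rewrite ger0_norm in hu.
  have dN y : dot y (- v) = - dot y v by exact: dotNr.
  apply: (hwlog (- v)); rewrite ?dN ?normrN//.
  - by rewrite dotNl opprK.
  - by move=> y Fy yx; rewrite dN normrN; exact: flat.
  - by rewrite ltr0_norm in hu.
have sepu := flat_upper_side oU flat.
have hw0 : dot (w' - x) v < - (eta * r).
  have [h|h] := leP 0 (dot (w' - x) v); last by rewrite ltr0_norm in hw => //; lra.
  by rewrite ger0_norm// in hw; case: nUw'; exact: (sepu u').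
exists v => // y yx; split => hy; first exact: (sepu u').
move=> Uy; apply: nUw'.
apply: (@flat_upper_side U x r eta (- v) y) => //; rewrite ?dotNr//; try lra.
by move=> z Fz zx; rewrite dotNr normrN; exact: flat.
Qed.

(** The balls of radius [3 / 20 * r] around [x + r / 4 *: v] and
    [x - r / 4 *: v] stay in [ecball x (r / 2)] and at height at least [r / 10]
    over or under the plane. *)
Lemma two_sided_of_split U x r eta : 0 < r -> eta <= 1 / 10 ->
  split_at U x (r / 2) eta -> two_sided U x r (3 / 20).
Proof.
move=> r0 eta1 [v v1 vU].
exists (x + (r / 4) *: v), (x - (r / 4) *: v).
have key y (s : R) : `|s| = 1 -> enorm (y - (x + (s * (r / 4)) *: v)) <= 3 / 20 * r ->
    enorm (y - x) <= r / 2 /\ r / 10 <= s * dot (y - x) v.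
  move=> s1 yu; have ss : s * s = 1.
    by rewrite -expr2 -[_ ^+ 2]real_normK ?num_real// s1 expr1n.
  have -> : y - x = (y - (x + (s * (r / 4)) *: v)) + (s * (r / 4)) *: v.
    by rewrite opprD addrA subrK.
  move: (y - _) yu => A yu; split.
    rewrite (le_trans (ler_enormD _ _))// enormZ (enorm_unit v1) mulr1.
    by rewrite normrM s1 mul1r ger0_norm; lra.
  have := le_trans (ler_dot_unit _ v1) yu.
  rewrite [in X in _ -> X]dotDl dotZl v1 mulr1; set q := dot _ v => hq.
  have -> : s * (q + s * (r / 4)) = s * q + s * s * (r / 4) by ring.
  rewrite ss mul1r.
  have : `|s * q| <= 3 / 20 * r by rewrite normrM s1 mul1r.
  by rewrite ler_norml => /andP[h _]; lra.
have eta_r : eta * (r / 2) <= r / 20 by nra.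
split=> y yu.
  have [|yx hy] := key y 1 (normr1 _); first by rewrite mul1r.
  split; last by lra.
  by apply: (vU y yx).1; lra.
have [||yx hy] := key y (-1); first by rewrite normrN1.
  by rewrite mulN1r scaleNr.
split; last by lra.
by apply: (vU y yx).2; lra.
Qed.

(** Over each point of the disc the two points at height [3 / 10 * r] above and
    below lie in the ball, since [89 / 100 + 9 / 100 < 1], and on different sides
    of the slab; the vertical segment between them meets the surface. *)
Lemma split_projection U x r : open U -> 0 < r -> split_at U x r (1 / 10) ->
  exists e1 e2 : 'rV[R]_3, [/\ dot e1 e1 = 1, dot e2 e2 = 1 &
    forall s : R * R, s.1 ^+ 2 + s.2 ^+ 2 <= 89 / 100 * r ^+ 2 ->
      exists2 y, (frontier U `&` ecball x r) y &
        s = (dot (y - x) e1, dot (y - x) e2)].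
Proof.
move=> oU r0 [v v1 vU]; have [e1 [e2 [u1 u2 e12 e1v e2v]]] := orthonormal_frame v1.
exists e1, e2; split => // -[s1 s2] /= hs.
pose q (t : R) := s1 *: e1 + s2 *: e2 + t *: v.
have qx t : dot (q t) (q t) = s1 ^+ 2 + s2 ^+ 2 + t ^+ 2.
  rewrite /q !dotE u1 u2 v1 e1v e2v !(dotC v) (dotC e2 e1) e12 e1v e2v; ring.
have qv t : dot (q t) v = t by rewrite /q !dotE e1v e2v v1; ring.
have q1 t : dot (q t) e1 = s1.
  by rewrite /q !dotE (dotC v) e1v (dotC e2) e12 u1; ring.
have q2 t : dot (q t) e2 = s2 by rewrite /q !dotE (dotC v) e2v e12 u2; ring.
have qr t : - (3 / 10 * r) <= t <= 3 / 10 * r -> enorm (q t) <= r.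
  by move=> /andP[t1 t2]; rewrite enorm_le ?(ltW r0)// qx; nra.
have Ua : U (x + q (3 / 10 * r)).
  apply: (vU _ _).1; rewrite addrC addKr.
    by rewrite qr//; lra.
  by rewrite qv; lra.
have nUb : ~ U (x + q (- (3 / 10 * r))).
  apply: (vU _ _).2; rewrite addrC addKr.
    by rewrite qr//; lra.
  by rewrite qv; lra.
have [t /andP[t0 t1]] := segment_meets_frontier oU Ua nUb.
have -> : x + q (3 / 10 * r) + t *: (x + q (- (3 / 10 * r)) - (x + q (3 / 10 * r))) =
    x + q (3 / 10 * r * (1 - 2 * t)).
  rewrite /q; apply/rowP => i; rewrite !mxE; ring.
move=> Fy; exists (x + q (3 / 10 * r * (1 - 2 * t))).
  split => //; rewrite /ecball/= addrC addKr qr//.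
  by apply/andP; split; nra.
by rewrite addrC addKr q1 q2.
Qed.

Lemma split_hausdorff2 U x r : open U -> 0 < r -> split_at U x r (1 / 10) ->
  ((pi / 2 * r ^+ 2)%:E <= hausdorff2 (frontier U `&` ecball x r))%E.
Proof.
move=> oU r0 /(split_projection oU r0)[e1 [e2 [u1 u2 cover]]].
apply: le_trans (hausdorff2_ge_projection (x := x) u1 u2
  (measurable_cross_shape r) _); last first.
  by move=> s /(cross_shape_disc r0); exact: cover.
have pi4 : 0 <= pi / 4 :> R by rewrite divr_ge0// pi_ge0.
apply: (@le_trans _ _ ((pi / 4)%:E * (2 * r ^+ 2)%:E)%E).
  by rewrite -EFinM lee_fin; lra.
by rewrite lee_wpmul2l// ?lee_fin//; exact: cross_shape_area.
Qed.

Lemma split_ediam U x r : open U -> 0 < r -> split_at U x r (1 / 10) ->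
  (r%:E <= ediam (frontier U))%E.
Proof.
move=> oU r0 /(split_projection oU r0)[e1 [e2 [u1 u2 cover]]].
have [|y [Fy _] [y1 _]] := cover (4 / 5 * r, 0) _; first by rewrite /=; nra.
have [|z [Fz _] [z1 _]] := cover (- (4 / 5 * r), 0) _; first by rewrite /=; nra.
apply: le_trans (enorm_le_ediam Fy Fz); rewrite lee_fin.
apply: le_trans (ler_dot_unit _ u1).
apply: le_trans (ler_norm _).
have -> : y - z = (y - x) - (z - x) by rewrite opprB addrA subrK.
by rewrite dotBl -y1 -z1; lra.
Qed.

End separation.

(** * Small energy forces flatness *)

Section energy_flatness.
Context (R : realType).
Implicit Types (S : set 'rV[R]_3) (x y : 'rV[R]_3) (r eta kappa p E : R).

(** Moving the vertices by [tolerance eta * r] changes each edge by twice that,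
    hence by [triple_perturb] the triple product by at most
    [14 * tolerance eta * r ^+ 3], half of [(eta * r) ^+ 3]. *)
Definition tolerance eta : R := eta ^+ 3 / 28.

(** The perturbed tetrahedron has triple product at least
    [eta ^+ 3 * r ^+ 3 / 2] and diameter at most [3 * r]; the constant is
    [2 * 12 * 3 ^ 4 = 1944]. *)
Lemma kernel_ge_near x y1 y2 y3 r eta (z0 z1 z2 z3 : 'rV[R]_3) :
  0 < r -> 0 < eta <= 1 ->
  enorm (y1 - x) <= r -> enorm (y2 - x) <= r -> enorm (y3 - x) <= r ->
  (eta * r) ^+ 3 <= `|triple (y1 - x) (y2 - x) (y3 - x)| ->
  enorm (z0 - x) <= tolerance eta * r -> enorm (z1 - y1) <= tolerance eta * r ->
  enorm (z2 - y2) <= tolerance eta * r -> enorm (z3 - y3) <= tolerance eta * r ->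
  eta ^+ 3 / (1944 * r) <= menger_kernel (tetra z0 z1 z2 z3).
Proof.
move=> r0 /andP[eta0 eta1] y1x y2x y3x vol z0x z1y z2y z3y.
have eta3 : 0 < eta ^+ 3 <= 1 by rewrite exprn_gt0//= exprn_ile1// ltW.
have eps : 0 < tolerance eta <= 1 / 28 by rewrite /tolerance; lra.
have d01 : 0 <= 2 * tolerance eta <= 1 by lra.
have near y z : enorm (z - y) <= tolerance eta * r ->
    enorm ((z - z0) - (y - x)) <= 2 * tolerance eta * r.
  move=> zy; have -> : z - z0 - (y - x) = (z - y) - (z0 - x).
    by apply/rowP => i; rewrite !mxE; ring.
  by rewrite (le_trans (ler_enormB _ _))//; lra.
have := triple_perturb (ltW r0) d01 y1x y2x y3x (near _ _ z1y) (near _ _ z2y)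
  (near _ _ z3y).
move=> vol'; set T := tetra z0 z1 z2 z3.
have Tx i : enorm (T i - x) <= 3 / 2 * r.
  have far y z : enorm (z - y) <= tolerance eta * r -> enorm (y - x) <= r ->
      enorm (z - x) <= 3 / 2 * r.
    by move=> zy yx; rewrite (le_trans (enorm_triangle y _ _))//; nra.
  case: i => -[|[|[|[|//]]]] i4; rewrite /T /tetra /=.
  - by apply: (far x) => //; rewrite subrr enorm0 ltW.
  - exact: (far y1).
  - exact: (far y2).
  - exact: (far y3).
have TT i j : enorm (T i - T j) <= 3 * r.
  rewrite (le_trans (enorm_triangle x _ _))// (enormB x).
  by have := Tx i; have := Tx j; lra.
have r3 : 0 < 3 * r by lra.
have t0 : 0 < eta ^+ 3 * r ^+ 3 / 2 by rewrite divr_gt0// mulr_gt0 ?exprn_gt0.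
apply: le_trans (menger_kernel_ge t0 r3 TT _).
  rewrite le_eqVlt; apply/orP; left; apply/eqP.
  by field; rewrite gt_eqF.
have half (a b s t : R) : s * t <= a -> a - 7 * (2 * (s / 28)) * t <= b ->
    s * t / 2 <= 6 * (b / 6) by move=> h1 h2; lra.
rewrite tetra_volumeE; apply: half vol'.
by rewrite -exprMn.
Qed.

(** If [S] is not flat in [ecball x r], then [wide_triple] gives a voluminous
    tetrahedron, and all tetrahedra with vertices near its vertices contribute
    to the energy; the lower mass bound says that there are many of them. *)
Lemma flat_of_energy S x r eta kappa p E : closed S -> S x ->
  0 < r -> 0 < eta <= 1 -> 0 <= kappa -> 0 <= p ->
  (forall y, S y -> ((kappa * (tolerance eta * r) ^+ 2)%:E <=
    hausdorff2 (S `&` ecball y (tolerance eta * r)))%E) ->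
  (menger_curvature p S <= E%:E)%E ->
  E < (eta ^+ 3 / (1944 * r)) `^ p * (kappa * (tolerance eta * r) ^+ 2) ^+ 4 ->
  flat_at S x r eta.
Proof.
move=> cS Sx r0 eta01 kappa0 p0 lowS SE Elt; apply: contrapT => nflat.
have [eta0 eta1] := andP eta01.
have [v v1|y1 [y2 [y3 [[S1 y1x] [S2 y2x] [S3 y3x] vol]]]] :=
    @wide_triple R (S `&` ecball x r) x (eta * r) (mulr_gt0 eta0 r0).
  apply: contrapT => nwide; apply: nflat; exists v => // y Sy yx.
  by rewrite leNgt; apply/negP => h; apply: nwide; exists y.
move: Elt; apply/negP; rewrite -leNgt -lee_fin; apply: le_trans SE.
have cl y : closed (S `&` ecball y (tolerance eta * r)).
  by apply: closedI => //; exact: closed_ecball.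
have k0 : 0 <= eta ^+ 3 / (1944 * r).
  apply: divr_ge0; first by rewrite exprn_ge0// ltW.
  by apply: mulr_ge0; [exact: ler0n|exact: ltW].
have m0 : 0 <= kappa * (tolerance eta * r) ^+ 2 by rewrite mulr_ge0 ?sqr_ge0.
apply: (menger_curvature_ge p0 k0 m0 (cl x) (cl y1) (cl y2) (cl y3)
  _ _ _ _ (lowS _ Sx) (lowS _ S1) (lowS _ S2) (lowS _ S3)).
1-4: by move=> z [].
move=> z0 z1 z2 z3 [_ z0x] [_ z1y] [_ z2y] [_ z3y].
exact: (kernel_ge_near r0 eta01 y1x y2x y3x vol).
Qed.

End energy_flatness.

(** * Lipschitz charts *)

Section charts.
Context (R : realType).
Implicit Types (S U : set 'rV[R]_3) (x y z e : 'rV[R]_3) (d M r : R).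

(** A Lipschitz graph chart without coordinates: [e] is the vertical direction
    and [F] the signed height over the graph. *)
Record chart S x d M e (F : 'rV[R]_3 -> R) : Prop := Chart {
  chart_unit : dot e e = 1;
  chart_shift : forall y t, F (y + t *: e) = F y + t;
  chart_lip : forall y z, `|F y - F z| <= M * enorm (y - z);
  chart_mem : forall y, enorm (y - x) <= d -> (S y <-> F y = 0) }.

Lemma dot_mulmx n (u v : 'rV[R]_n) : dot u v = (u *m v^T) 0 0.
Proof. by rewrite mxE; apply: eq_bigr => i _; rewrite mxE. Qed.

Lemma dot_orthogonal n (Q : 'M[R]_n) (u v : 'rV[R]_n) : Q *m Q^T = 1%:M ->
  dot (u *m Q) (v *m Q) = dot u v.
Proof. by move=> QQ; rewrite !dot_mulmx trmx_mul mulmxA -(mulmxA u) QQ mulmx1. Qed.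

Lemma enorm_lsubmx (w : 'rV[R]_(2 + 1)) : enorm (lsubmx w) <= enorm w.
Proof.
rewrite ler_sqrt ?dot_ge0// /dot big_split_ord/=.
apply: ler_wpDr; first by apply: sumr_ge0 => i _; rewrite -expr2 sqr_ge0.
by rewrite le_eqVlt; apply/orP; left; apply/eqP/eq_bigr => i _; rewrite !mxE.
Qed.

Lemma surface_chart S x : lipschitz_surface S -> S x ->
  exists d M e F, [/\ 0 < d, 0 <= M & chart S x d M e F].
Proof.
move=> [_ _ _ /(_ x)/[apply] -[phi [f [[Q [b [QQ _ phiE]]] [L fL] /nbhs_enorm[d d0 dP]]]]].
pose j : 'I_(2 + 1) := rshift 2 ord0.
pose delta : 'rV[R]_3 := delta_mx 0 j.
pose e := delta *m Q^T.
have eQ : e *m Q = delta by rewrite -mulmxA (mulmx1C QQ) mulmx1.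
pose F y := phi y 0 j - f (lsubmx (phi y : 'rV[R]_(2 + 1))).
exists d, (1 + `|L|), e, F; split => //.
have phiB y z : enorm (phi y - phi z) = enorm (y - z).
  rewrite !phiE opprD addrACA subrr addr0 -mulmxBl.
  by rewrite /enorm dot_orthogonal.
split.
- rewrite -(dot_orthogonal e e QQ) eQ dot_mulmx /delta trmx_delta mul_delta_mx.
  by rewrite mxE !eqxx.
- move=> y t; have -> : F (y + t *: e) = F y + t; last by [].
  have phi_t : phi (y + t *: e) = phi y + t *: delta.
    by rewrite !phiE mulmxDl -scalemxAl eQ addrAC.
  rewrite /F phi_t; have -> : lsubmx (phi y + t *: delta : 'rV_(2 + 1)) =
      lsubmx (phi y : 'rV_(2 + 1)).
    apply/rowP => i; rewrite !mxE /=.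
    have /negPf -> : lshift 1 i != j by rewrite -val_eqE /= neq_ltn ltn_ord.
    by rewrite mulr0 addr0.
  by rewrite !mxE !eqxx mulr1 addrAC.
- move=> y z; rewrite /F.
  have -> : phi y 0 j - f (lsubmx (phi y : 'rV[R]_(2 + 1))) -
     (phi z 0 j - f (lsubmx (phi z : 'rV[R]_(2 + 1)))) = (phi y - phi z) 0 j -
     (f (lsubmx (phi y : 'rV[R]_(2 + 1))) - f (lsubmx (phi z : 'rV[R]_(2 + 1)))).
    by rewrite !mxE; ring.
  rewrite (le_trans (ler_normB _ _))// mulrDl mul1r lerD//.
    by rewrite -phiB; exact: ler_coord.
  rewrite (le_trans (fL _ _))//.
  apply: (@le_trans _ _ (`|L| * enorm (lsubmx (phi y : 'rV[R]_(2 + 1)) -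
      lsubmx (phi z : 'rV[R]_(2 + 1))))).
    by rewrite ler_wpM2r ?enorm_ge0// ler_norm.
  by rewrite ler_wpM2l// -phiB -linearB; exact: enorm_lsubmx.
- move=> y /dP ->; rewrite /F; split.
    move=> [u _ <-]; rewrite row_mxKl; apply/eqP; rewrite subr_eq0; apply/eqP.
    have : (row_mx u (f u)%:M : 'rV[R]_(2 + 1)) 0 j = f u.
      by rewrite row_mxEr mxE eqxx mulr1n.
    exact.
  move=> /eqP; rewrite subr_eq0 => /eqP Fy; exists (lsubmx (phi y : 'rV[R]_(2 + 1))) => //.
  rewrite -Fy -[RHS](@hsubmxK _ 1 2 1); congr row_mx.
  by apply/rowP => i; rewrite !mxE (ord1 i) eqxx mulr1n.
Qed.

Lemma chart_near S x x' d d' M M' e F : chart S x d M e F ->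
  enorm (x' - x) + d' <= d -> M <= M' -> chart S x' d' M' e F.
Proof.
move=> [e1 Fe Flip FS] x'x MM; split => //.
  by move=> y z; rewrite (le_trans (Flip y z))// ler_wpM2r ?enorm_ge0.
move=> y yx'; apply: FS; rewrite (le_trans (enorm_triangle x' _ _))//.
by rewrite addrC (le_trans _ x'x)// lerD2l.
Qed.

(** Exchanges the two sides of the graph. *)
Lemma chart_opp S x d M e F : chart S x d M e F -> chart S x d M (- e) (\- F).
Proof.
move=> [e1 Fe Flip FS]; split.
- by rewrite dotNl dotNr opprK.
- by move=> y t /=; rewrite scalerN -scaleNr Fe opprD opprK.
- by move=> y z /=; rewrite -opprD normrN.
- move=> y /FS ->; split => /= [->|/eqP]; first by rewrite oppr0.
  by rewrite oppr_eq0 => /eqP.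
Qed.

(** The radius shrinks and the Lipschitz constant grows with [n], so one [n]
    serves the whole compact surface. *)
Lemma surface_uniform_chart S : lipschitz_surface S ->
  exists d M, [/\ 0 < d, 0 <= M & forall x, S x -> exists e F, chart S x d M e F].
Proof.
move=> Ssurf; have [cS _ _ _] := Ssurf.
have /compact_near_coveringP cov := cS.
have : \forall n \near \oo, forall x, S x ->
    S x -> exists e F, chart S x n.+1%:R^-1 n%:R e F.
  apply: (cov nat \oo (fun n x => S x -> exists e F, chart S x n.+1%:R^-1 n%:R e F)).
  move=> x Sx; have [d [M [e [F [d0 M0 ch]]]]] := surface_chart Ssurf Sx.
  have near_x : \forall x' \near x, enorm (x' - x) <= d / 2.
    by apply/nbhs_enorm; exists (d / 2) => //; rewrite divr_gt0.
  have near_n : \forall n \near \oo, M <= n%:R /\ n.+1%:R^-1 <= d / 2.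
    near=> n; split; first by near: n; exact: nbhs_infty_ger.
    rewrite invf_ple ?posrE ?divr_gt0//; apply: (@le_trans _ _ n%:R); last by rewrite ler_nat.
    by near: n; exact: nbhs_infty_ger.
  near=> x' n => Sx'; exists e, F.
  have [Mn nd] : M <= n%:R /\ n.+1%:R^-1 <= d / 2 by near: n.
  have x'x : enorm (x' - x) <= d / 2 by near: x'.
  by apply: (chart_near ch) => //; rewrite (splitr d) lerD.
move=> [n _ /(_ n (leqnn n)) /= h]; exists n.+1%:R^-1, n%:R.
by split => // x Sx; exact: h.
Unshelve. all: by end_near. Qed.

End charts.

Section sides.
Context (R : realType).
Implicit Types (S U : set 'rV[R]_3) (x y z e : 'rV[R]_3) (d M r : R).

(** Two points above the graph are joined by going up, across and down again;
    the height [2 * M * r] keeps the horizontal part above the graph. *)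
Lemma chart_upper_side U x d M e F y z r : open U -> 0 <= M ->
  chart (frontier U) x d M e F -> (1 + 2 * M) * r <= d ->
  enorm (y - x) <= r -> enorm (z - x) <= r -> 0 < F y -> 0 < F z -> U y -> U z.
Proof.
move=> oU M0 [e1 Fe Flip FS] rd yx zx Fy0 Fz0 Uy.
have r0 : 0 <= r := le_trans (enorm_ge0 _) yx.
pose h := 2 * M * r; have h0 : 0 <= h by rewrite !mulr_ge0.
have r_le : r <= (1 + 2 * M) * r by rewrite mulrDl mul1r lerDl.
have up w (t : R) : enorm (w - x) <= r -> 0 <= t <= h -> enorm (w + t *: e - x) <= d.
  move=> wx /andP[t0 th]; rewrite addrAC (le_trans (ler_enormD _ _))//.
  rewrite enormZ (enorm_unit e1) mulr1 ger0_norm// (le_trans _ rd)//.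
  by rewrite mulrDl mul1r lerD.
have vert w (s : R) : enorm (w - x) <= r -> 0 < F w -> 0 <= s <= 1 ->
    ~ frontier U (w + (s * h) *: e).
  move=> wx Fw /andP[s0 s1]; rewrite FS; last first.
    by apply: up => //; rewrite mulr_ge0//= ler_piMl.
  by rewrite Fe => /eqP; rewrite gt_eqF// ltr_pwDl// mulr_ge0.
have U1 : U (y + h *: e).
  apply: segment_stays Uy => // t t01.
  by rewrite (addrC y (h *: e)) addrK scalerA; exact: vert.
have U2 : U (z + h *: e).
  apply: segment_stays U1 => // t t01.
  rewrite FS; last first.
    by apply: enorm_segment => //; apply: up => //; rewrite h0 lexx.
  have -> : z + h *: e - (y + h *: e) = z - y by rewrite opprD addrACA subrr addr0.
  rewrite addrAC Fe => /eqP; rewrite gt_eqF//.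
  have [t0 t1] := andP t01.
  have := Flip (y + t *: (z - y)) y.
  rewrite (addrC y) addrK (addrC _ y) enormZ (ger0_norm t0).
  have zy : enorm (z - y) <= 2 * r.
    by rewrite (le_trans (enorm_triangle x _ _))// (enormB x)//; lra.
  have bound : M * (t * enorm (z - y)) <= h.
    have -> : h = M * (2 * r) by rewrite /h; ring.
    rewrite ler_wpM2l// (le_trans _ zy)// ler_piMl ?enorm_ge0//.
  move=> /le_trans/(_ bound); rewrite ler_norml => /andP[h1 _].
  by lra.
apply: segment_stays U2 => // t /andP[t0 t1].
have -> : z + h *: e + t *: (z - (z + h *: e)) = z + ((1 - t) * h) *: e.
  by apply/rowP => i; rewrite !mxE; ring.
by apply: vert => //; lra.
Qed.

Lemma interior_of_closure U y : open U -> closure U y -> ~ frontier U y -> U y.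
Proof.
by move=> oU cUy nF; apply: contrapT => nU; apply: nF; split => // /interior_subset.
Qed.

Lemma frontier_open U y : open U -> U y -> ~ frontier U y.
Proof. by move=> oU Uy [_ nU]; apply: nU; exact: open_nbhs_nbhs. Qed.

(** If the closure of [U] is a neighbourhood of one point [a] of the graph, then
    [U] contains points just above and just below [a], hence both sides. *)
Lemma chart_both_sides U x d M e F r a : open U -> 0 <= M ->
  chart (frontier U) x d M e F -> 0 < r -> (1 + 2 * M) * r <= d ->
  frontier U a -> enorm (a - x) <= r / 2 -> (closure U)^° a ->
  forall y, enorm (y - x) <= r -> closure U y.
Proof.
move=> oU M0 ch r0 rd Fa ax /nbhs_enorm[s s0 sU] y yx.
have [e1 Fe Flip FS] := ch.
have r_le : r <= d.
  by rewrite (le_trans _ rd)// mulrDl mul1r lerDl mulr_ge0// ?mulr_ge0// ltW.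
have Fa0 : F a = 0 by apply/FS => //; lra.
pose t := Num.min s (r / 2).
have t0 : 0 < t by rewrite lt_min s0 divr_gt0.
have ts : t <= s by rewrite ge_min lexx.
have tr : t <= r / 2 by rewrite ge_min lexx orbT.
have near (q : R) : `|q| = t -> [/\ enorm (a + q *: e - x) <= r,
    closure U (a + q *: e) & F (a + q *: e) = q].
  move=> qt; split; last by rewrite Fe Fa0 add0r.
    rewrite addrAC (le_trans (ler_enormD _ _))// enormZ (enorm_unit e1) mulr1 qt.
    by lra.
  by apply: sU; rewrite addrC addKr enormZ (enorm_unit e1) mulr1 qt.
have nF (q : R) : `|q| = t -> U (a + q *: e).
  move=> qt; have [qr cq Fq] := near q qt; apply: interior_of_closure => //.
  rewrite FS ?(le_trans qr)// Fq => q0.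
  by rewrite q0 normr0 in qt; rewrite -qt ltxx in t0.
have [Fy|Fy|Fy] := ltgtP (F y) 0.
- apply: subset_closure; have [qr _ Fq] := near (- t) (etrans (normrN _) (gtr0_norm t0)).
  apply: (chart_upper_side oU M0 (chart_opp ch) rd qr yx).
  + by rewrite /= Fq opprK.
  + by rewrite /= oppr_gt0.
  + by apply: nF; rewrite normrN gtr0_norm.
- apply: subset_closure; have [qr _ Fq] := near t (gtr0_norm t0).
  apply: (chart_upper_side oU M0 ch rd qr yx) => //; first by rewrite Fq.
  by apply: nF; rewrite gtr0_norm.
- by apply FS in Fy; [case: Fy|exact: le_trans r_le].
Qed.

Lemma bounded_set_enorm (A : set 'rV[R]_3) : bounded_set A ->
  exists B : R, 0 <= B /\ A `<=` ecball 0 B.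
Proof.
move=> [N [Nr AN]]; have N1 : 0 <= `|N| + 1 by rewrite addr_ge0.
exists (3%:R * (`|N| + 1)); split; first by rewrite mulr_ge0.
have NN : N < `|N| + 1 by rewrite (le_lt_trans (ler_norm _))// ltrDl.
move=> y /(AN _ NN) /= yN; rewrite /ecball /= subr0.
apply: enorm_le_sup => // i; apply: le_trans yN.
rewrite [leRHS]mx_normrE.
exact: (le_bigmax _ (fun ij : 'I_1 * 'I_3 => `|y ij.1 ij.2|) (0, i)).
Qed.

(** The surface is not a slit inside [U].  By [chart_both_sides] the set of
    points of [S] at which [U] lies on both sides is closed and open in the
    connected set [S].  If it were all of [S], then the closure of [U] would be
    open, and a segment leaving this bounded set would meet its empty
    frontier. *)
Lemma frontier_no_slit S U : lipschitz_surface S -> open U -> U !=set0 ->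
  bounded_set U -> S = frontier U -> forall a, S a -> ~ (closure U)^° a.
Proof.
move=> Ssurf oU [u Uu] bU SU a Sa ia.
have [_ connS _ _] := Ssurf.
pose A := S `&` (closure U)^°.
have AS : A = S.
  apply: connS; first by exists a.
    by exists ((closure U)^°) => //; exact: open_interior.
  exists (closure A); first exact: closed_closure.
  apply/seteqP; split => [x Ax|x [Sx cAx]]; first by split; [case: Ax|exact: subset_closure].
  split => //.
  have [d [M [e [F [d0 M0 ch]]]]] := surface_chart Ssurf Sx.
  pose r := d / (1 + 2 * M).
  have M1 : 0 < 1 + 2 * M by lra.
  have r0 : 0 < r by rewrite divr_gt0.
  have rd : (1 + 2 * M) * r <= d by rewrite mulrC divfK ?gt_eqF.
  have [|b [[Sb ib] bx]] := cAx [set b | enorm (b - x) <= r / 2].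
    by apply/nbhs_enorm; exists (r / 2) => //; rewrite divr_gt0.
  apply/nbhs_enorm; exists r => //.
  by rewrite SU in Sb ch; exact: (chart_both_sides oU M0 ch r0 rd Sb).
have oclU : open (closure U).
  rewrite openE => x cx; have [Sx|nS] := pselect (S x).
    by move: Sx; rewrite -AS => -[].
  have Ux : U x by apply: interior_of_closure => //; rewrite -SU.
  apply: filterS (@subset_closure _ U) _.
  exact: open_nbhs_nbhs.
have [B [B0 UB]] := bounded_set_enorm bU.
have nb : ~ closure U (vec3 (B + 1) 0 0).
  move=> /(closure_subset UB); rewrite -(closure_id _).1; last exact: closed_ecball.
  rewrite /ecball /= subr0 => /(le_trans (ler_coord _ 0)).
  by rewrite vec3E ger0_norm; lra.
have [t _ [ct nt]] := segment_meets_frontier oclU (subset_closure Uu) nb.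
apply: nt; move: ct; rewrite -(closure_id _).1; last exact: closed_closure.
by move=> ct; exact: open_nbhs_nbhs.
Qed.

End sides.

Section small_scales.
Context (R : realType).
Implicit Types (S U : set 'rV[R]_3) (x y z e : 'rV[R]_3) (d M r : R).

(** The graph projects onto the square of half-side [h] in the plane orthogonal to
    [e], and over that square it stays within distance
    [(1 + M) * (h + h) = r] of [x]. *)
Lemma chart_hausdorff2_ge S x d M e F r : 0 <= M -> chart S x d M e F -> S x ->
  0 < r <= d ->
  ((pi / 4 / (1 + M) ^+ 2 * r ^+ 2)%:E <= hausdorff2 (S `&` ecball x r))%E.
Proof.
move=> M0 [e1 Fe Flip FS] Sx /andP[r0 rd].
have [f1 [f2 [u1 u2 u12 f1e f2e]]] := orthonormal_frame e1.
have M1 : 0 < 1 + M by rewrite ltr_wpDr.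
pose h := r / (2 * (1 + M)).
have h0 : 0 < h by rewrite divr_gt0// mulr_gt0.
have hr : (1 + M) * (h + h) = r by rewrite /h; field; rewrite gt_eqF.
have Fx : F x = 0 by apply/FS => //; rewrite subrr enorm0 (le_trans _ rd)// ltW.
pose Q : set (R * R) := [set` `[- h, h]] `*` [set` `[- h, h]].
have mQ : measurable Q by exact: measurableX.
have pi4 : 0 <= pi / 4 :> R by rewrite divr_ge0// pi_ge0.
apply: le_trans (hausdorff2_ge_projection (x := x) u1 u2 mQ _); last first.
  move=> [s t] [/=]; rewrite !in_itv/= -!ler_norml => sh th.
  pose w := s *: f1 + t *: f2.
  have wh : enorm w <= h + h.
    by rewrite (le_trans (ler_enormD _ _))// !enormZ !enorm_unit// !mulr1 lerD.
  pose q := F (x + w).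
  have qh : `|q| <= M * (h + h).
    have := Flip (x + w) x; rewrite Fx subr0 (addrC x) addrK (addrC _ x) => /le_trans; apply.
    by rewrite ler_wpM2l.
  have yx : x + (w - q *: e) - x = w - q *: e by rewrite addrC addKr.
  have yr : enorm (w - q *: e) <= r.
    rewrite (le_trans (ler_enormB _ _))// enormZ (enorm_unit e1) mulr1 -hr.
    by rewrite mulrDl mul1r lerD.
  exists (x + (w - q *: e)).
    split; last by rewrite /ecball/= yx.
    apply/FS; first by rewrite yx (le_trans yr).
    by rewrite addrA -scaleNr Fe subrr.
  by rewrite yx /w !dotE u1 u2 (dotC f2 f1) u12 !(dotC e) f1e f2e; congr pair; ring.
rewrite leb2_rectangle lebesgue_measure_itv/= lte_fin ifT; last by lra.
rewrite -EFinB -!EFinM lee_fin le_eqVlt; apply/orP; left; apply/eqP.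
by rewrite /h; field; rewrite gt_eqF.
Qed.

Lemma chart_two_sided_oriented U x d M e F r : open U -> 0 <= M ->
  chart (frontier U) x d M e F -> frontier U x ->
  0 < r -> (1 + 2 * M) * r <= d ->
  U (x + (r / 2) *: e) -> ~ U (x - (r / 2) *: e) ->
  two_sided U x r (1 / (4 * (1 + M))).
Proof.
move=> oU M0 ch Fx r0 rd Up nUn; have [e1 Fe Flip FS] := ch.
have d0 : 0 <= d by rewrite (le_trans _ rd)// mulr_ge0 ?addr_ge0 ?mulr_ge0// ltW.
have Fx0 : F x = 0 by apply/FS => //; rewrite subrr enorm0.
have M1 : 0 < 1 + M by rewrite ltr_wpDr.
set c := 1 / _; have c0 : 0 < c by rewrite divr_gt0// mulr_gt0.
have cM : c + M * c = 1 / 4 by rewrite /c; field; rewrite gt_eqF.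
have Mc0 : 0 <= M * c by rewrite mulr_ge0// ltW.
have near (s : R) y : `|s| = 1 -> enorm (y - (x + (s * (r / 2)) *: e)) <= c * r ->
    enorm (y - x) <= r /\ r / 4 <= s * F y.
  move=> s1 ys; split.
    rewrite (le_trans (enorm_triangle (x + (s * (r / 2)) *: e) _ _))//.
    rewrite [x + _ - x]addrC addKr enormZ (enorm_unit e1) mulr1 normrM s1 mul1r.
    by rewrite ger0_norm; nra.
  have := Flip y (x + (s * (r / 2)) *: e); rewrite Fe Fx0 add0r.
  have := ler_wpM2l M0 ys; set E := enorm _ => ME /le_trans/(_ ME) hF.
  have ss : s * s = 1 by rewrite -expr2 -[_ ^+ 2]real_normK ?num_real// s1 expr1n.
  have : `|s * (F y - s * (r / 2))| <= M * (c * r) by rewrite normrM s1 mul1r.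
  rewrite ler_norml => /andP[h _].
  have : s * (F y - s * (r / 2)) = s * F y - (s * s) * (r / 2) by ring.
  by rewrite ss => hs; nra.
have pe (s : R) : `|s| = 1 ->
    enorm (x + (s * (r / 2)) *: e - (x + (s * (r / 2)) *: e)) <= c * r.
  by move=> _; rewrite subrr enorm0 mulr_ge0// ltW.
have s1 := normr1 R; have sN1 : `|- 1 : R| = 1 by rewrite normrN1.
have [px pF] := near _ _ s1 (pe _ s1); have [nx nF] := near _ _ sN1 (pe _ sN1).
rewrite mul1r mulN1r ?scaleNr in px pF nx nF.
exists (x + (r / 2) *: e), (x - (r / 2) *: e); split => y yu.
  have [|yx Fy] := near 1 y s1; first by rewrite mul1r.
  split => //; apply: (chart_upper_side oU M0 ch rd px yx) => //; lra.
have [|yx Fy] := near (-1) y sN1; first by rewrite mulN1r scaleNr.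
split => // Uy; apply: nUn.
by apply: (chart_upper_side oU M0 (chart_opp ch) rd yx nx) => //=; lra.
Qed.

(** Each side of the graph lies in [U] or in its complement.  Both in [U] is
    excluded by [frontier_no_slit], both in the complement because [x] is in the
    closure of [U]. *)
Lemma chart_two_sided S U x d M e F r : lipschitz_surface S -> open U ->
  U !=set0 -> bounded_set U -> S = frontier U -> 0 <= M ->
  chart S x d M e F -> S x -> 0 < r -> (1 + 2 * M) * r <= d ->
  two_sided U x r (1 / (4 * (1 + M))).
Proof.
move=> Ssurf oU U0 bU SU M0 ch Sx r0 rd.
have noslit := frontier_no_slit Ssurf oU U0 bU SU Sx.
rewrite SU in ch Sx; have ch' := chart_opp ch; have [e1 Fe Flip FS] := ch.
have r_le : r <= d.
  by rewrite (le_trans _ rd)// mulrDl mul1r lerDl mulr_ge0// ?mulr_ge0// ltW.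
have Fx0 : F x = 0 by apply/FS => //; rewrite subrr enorm0 (le_trans (ltW r0)).
have px : enorm (x + (r / 2) *: e - x) <= r.
  by rewrite addrC addKr enormZ (enorm_unit e1) mulr1 ger0_norm; lra.
have nx : enorm (x - (r / 2) *: e - x) <= r.
  by rewrite addrC addKr enormN enormZ (enorm_unit e1) mulr1 ger0_norm; lra.
have Fp : F (x + (r / 2) *: e) = r / 2 by rewrite Fe Fx0 add0r.
have Fn : F (x - (r / 2) *: e) = - (r / 2) by rewrite -scaleNr Fe Fx0 add0r.
have [Up|nUp] := pselect (U (x + (r / 2) *: e));
  have [Un|nUn] := pselect (U (x - (r / 2) *: e)).
- exfalso; apply: noslit; apply/nbhs_enorm; exists r => // y yx.
  have [Fy|Fy|Fy] := ltgtP (F y) 0.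
  + apply: subset_closure; apply: (chart_upper_side oU M0 ch' rd nx yx) => //=; lra.
  + apply: subset_closure; apply: (chart_upper_side oU M0 ch rd px yx) => //=; lra.
  + by apply FS in Fy; [case: Fy|exact: le_trans r_le].
- exact: (chart_two_sided_oriented oU M0 ch).
- apply: (chart_two_sided_oriented oU M0 ch') => //; first by rewrite scalerN.
  by rewrite scalerN opprK.
- exfalso; have [cUx _] := Sx.
  have [|y [Uy yx]] := cUx [set y | enorm (y - x) <= r].
    by apply/nbhs_enorm; exists r.
  have [Fy|Fy|Fy] := ltgtP (F y) 0.
  + by apply: nUn; apply: (chart_upper_side oU M0 ch' rd yx nx) => //=; lra.
  + by apply: nUp; apply: (chart_upper_side oU M0 ch rd yx px) => //=; lra.
  + apply FS in Fy; last exact: le_trans r_le.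
    exact: (frontier_open oU Uy).
Qed.

End small_scales.

(** * From small scales to the threshold *)

Section scales.
Context (R : realType).
Implicit Types (S U : set 'rV[R]_3) (x y : 'rV[R]_3) (p E A K D r : R).

(** Multiplied by [r `^ (p - 8)] the right-hand side becomes
    [A `^ p * K ^+ 4], while [E] becomes at most [D].  This is where [8 < p]
    enters: four two-dimensional masses give the exponent 8. *)
Lemma energy_threshold p E A K D r : 8 < p -> 0 < E -> 0 < A ->
  0 <= D < A `^ p * K ^+ 4 -> 0 < r <= (D / E) `^ (1 / (p - 8)) ->
  E < (A / r) `^ p * (K * r ^+ 2) ^+ 4.
Proof.
move=> p8 E0 A0 /andP[D0 DAK] /andP[r0 rD].
have q0 : 0 < p - 8 by rewrite subr_gt0.
have DE0 : 0 <= D / E by rewrite divr_ge0// ltW.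
have rq : E * r `^ (p - 8) <= D.
  rewrite mulrC -ler_pdivlMr//.
  have := @ge0_ler_powR R (p - 8) (ltW q0) r _ _ _ rD.
  rewrite !nnegrE => /(_ (ltW r0) (powR_ge0 _ _)).
  by rewrite -powRrM mul1r mulVf ?gt_eqF// powRr1.
have rq0 : 0 < r `^ (p - 8) by exact: powR_gt0.
rewrite -(ltr_pM2r rq0); apply: le_lt_trans rq _; apply: lt_le_trans DAK _.
rewrite le_eqVlt; apply/orP; left; apply/eqP.
rewrite powRM ?invr_ge0 ?(ltW A0) ?(ltW r0)//.
have r8 : r `^ p = r `^ (p - 8) * r ^+ 8.
  rewrite -powR_mulrn ?(ltW r0)// -powRD ?subrK//.
  by apply/implyP => _; rewrite gt_eqF.
have rV : r^-1 `^ p * r `^ p = 1.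
  by rewrite -powRM ?invr_ge0 ?(ltW r0)// mulVf ?gt_eqF// powR1.
transitivity (A `^ p * K ^+ 4 * (r^-1 `^ p * r `^ p)); first by rewrite rV mulr1.
by rewrite r8; ring.
Qed.

Lemma split_at_weaken U x r (eta eta' : R) : 0 < r -> eta <= eta' ->
  split_at U x r eta -> split_at U x r eta'.
Proof.
move=> r0 ee [v v1 vU]; exists v => // y yx.
have er : eta * r <= eta' * r by rewrite ler_wpM2r// ltW.
have [h1 h2] := vU y yx; split => h; first by apply: h1; exact: le_lt_trans h.
by apply: h2; apply: lt_le_trans h _; rewrite lerN2.
Qed.

Lemma closed_frontier U : closed (frontier U).
Proof.
apply: closedI; first exact: closed_closure.
by rewrite closedC; exact: open_interior.
Qed.

Lemma split_of_energy U x r eta c kappa p E D :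
  let S := frontier U in
  open U -> S x -> 0 < r -> 0 < eta <= 1 / 10 -> eta < c -> 0 < kappa ->
  8 < p -> 0 < E -> (menger_curvature p S <= E%:E)%E ->
  (forall y, S y -> ((kappa * (tolerance eta * r) ^+ 2)%:E <=
    hausdorff2 (S `&` ecball y (tolerance eta * r)))%E) ->
  0 <= D < (eta ^+ 3 / 1944) `^ p * (kappa * tolerance eta ^+ 2) ^+ 4 ->
  r <= (D / E) `^ (1 / (p - 8)) ->
  two_sided U x r c -> split_at U x r (1 / 10).
Proof.
move=> S oU Sx r0 /andP[eta0 eta1] etac kappa0 p8 E0 SE lowS hD rD two.
have a0 : 0 < eta ^+ 3 / 1944.
  by apply: divr_gt0; [exact: exprn_gt0|exact: ltr0n].
apply: (split_at_weaken r0 eta1).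
apply: (split_of_flat oU r0 _ _ two); first by rewrite ltW.
apply: (@flat_of_energy _ _ _ _ _ kappa p E) => //.
- exact: closed_frontier.
- by rewrite eta0; lra.
- exact: ltW.
- by lra.
have r0D : 0 < r <= (D / E) `^ (1 / (p - 8)) by rewrite r0.
have := energy_threshold p8 E0 a0 hD r0D.
have -> : eta ^+ 3 / 1944 / r = eta ^+ 3 / (1944 * r).
  by rewrite invfM mulrA.
have -> : kappa * tolerance eta ^+ 2 * r ^+ 2 = kappa * (tolerance eta * r) ^+ 2.
  by ring.
exact.
Qed.

(** The start of the induction.  The constants come from the charts and depend
    on the surface, but with finite energy and [8 < p] they still yield flatness
    at all sufficiently small scales. *)
Lemma split_small_scales S U p E : lipschitz_surface S -> open U ->
  U !=set0 -> bounded_set U -> S = frontier U ->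
  8 < p -> 0 < E -> (menger_curvature p S <= E%:E)%E ->
  exists2 r1 : R, 0 < r1 &
    forall x r, S x -> 0 < r <= r1 -> split_at U x r (1 / 10).
Proof.
move=> Ssurf oU U0 bU SU p8 E0 SE.
have [d [M [d0 M0 ch]]] := surface_uniform_chart Ssurf.
have M1 : 0 < 1 + M by rewrite ltr_wpDr.
pose kappa := pi / 4 / (1 + M) ^+ 2.
have kappa0 : 0 < kappa by rewrite !divr_gt0 ?pi_gt0 ?exprn_gt0.
pose c := 1 / (4 * (1 + M)).
have c0 : 0 < c by rewrite divr_gt0// mulr_gt0.
have c4 : c <= 1 / 4.
  by rewrite /c !div1r lef_pV2 ?posrE ?mulr_gt0//; lra.
pose eta := c / 3.
have eta0 : 0 < eta by rewrite divr_gt0.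
have eta1 : eta <= 1 / 10 by rewrite /eta; lra.
have etac : eta < c by rewrite /eta; lra.
have tol0 : 0 < tolerance eta by rewrite divr_gt0// exprn_gt0.
have tol1 : tolerance eta <= 1.
  have : eta ^+ 3 <= 1 by rewrite exprn_ile1//; lra.
  by rewrite /tolerance; lra.
pose B := (eta ^+ 3 / 1944) `^ p * (kappa * tolerance eta ^+ 2) ^+ 4.
have B0 : 0 < B.
  apply: mulr_gt0; last by rewrite exprn_gt0// mulr_gt0// exprn_gt0.
  by apply: powR_gt0; apply: divr_gt0; [exact: exprn_gt0|exact: ltr0n].
pose rE := (B / 2 / E) `^ (1 / (p - 8)).
have rE0 : 0 < rE by rewrite powR_gt0// !divr_gt0.
have M2 : 0 < 1 + 2 * M by lra.
have rd0 : 0 < d / (1 + 2 * M) by rewrite divr_gt0.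
exists (Num.min (d / (1 + 2 * M)) rE); first by rewrite lt_min rd0 rE0.
move=> x r Sx /andP[r0]; rewrite le_min => /andP[rd rrE].
have [e [F chx]] := ch x Sx.
have rMd : (1 + 2 * M) * r <= d by rewrite mulrC -ler_pdivlMr.
have two := chart_two_sided Ssurf oU U0 bU SU M0 chx Sx r0 rMd.
have r_le : r <= d.
  by rewrite (le_trans _ rMd)// mulrDl mul1r lerDl mulr_ge0// ?mulr_ge0// ltW.
apply: (@split_of_energy U x r eta c kappa p E (B / 2)); rewrite -?SU//.
- by rewrite eta0.
- move=> y Sy; have [e' [F' chy]] := ch y Sy.
  apply: (chart_hausdorff2_ge M0 chy Sy).
  by rewrite mulr_gt0//= (le_trans _ r_le)// ler_piMl// ltW.
- by rewrite divr_ge0 ?(ltW B0)//= -/B; lra.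
Qed.

(** The constants for [eta = 1 / 10] and the mass bound [pi / 2]: on
    tetrahedra of scale [r] the kernel is at least [base_kernel / r], and each
    vertex ranges over mass at least [base_mass * r ^+ 2]. *)
Definition base_kernel : R := (1 / 10) ^+ 3 / 1944.
Definition base_mass : R := pi / 2 * tolerance (1 / 10 : R) ^+ 2.

(** Doubling the scale.  Splitting at all points and all scales up to [r / 2]
    gives the mass bound with the absolute constant [pi / 2], which by
    [flat_of_energy] gives flatness at scale [r], and with the corkscrew balls
    inherited from scale [r / 2] also splitting at scale [r]. *)
Lemma split_up_to S U p E D : lipschitz_surface S -> open U ->
  U !=set0 -> bounded_set U -> S = frontier U ->
  8 < p -> 0 < E -> (menger_curvature p S <= E%:E)%E ->
  0 <= D < base_kernel `^ p * base_mass ^+ 4 ->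
  forall x r, S x -> 0 < r -> r <= (D / E) `^ (1 / (p - 8)) ->
    split_at U x r (1 / 10).
Proof.
move=> Ssurf oU U0 bU SU p8 E0 SE hD.
have [r1 r10 small] := split_small_scales Ssurf oU U0 bU SU p8 E0 SE.
suff climb n x r : S x -> 0 < r -> r <= (D / E) `^ (1 / (p - 8)) ->
    r <= 2 ^+ n * r1 -> split_at U x r (1 / 10).
  move=> x r Sx r0 rD; apply: (climb (Num.truncn (r / r1)).+1) => //.
  rewrite -ler_pdivrMr//.
  have : r / r1 < (Num.truncn (r / r1)).+1%:R by rewrite real_truncnS_gt// num_real.
  move=> /ltW/le_trans; apply; rewrite -natrX ler_nat.
  exact/ltnW/ltn_expl.
elim: n x r => [|n IH] x r Sx r0 rD rn.
  by apply: small => //; rewrite r0 -(mul1r r1) -(expr0 2).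
have tol : 0 < tolerance (1 / 10 : R) <= 1 / 2 by rewrite /tolerance; lra.
have [tol0 tol1] := andP tol.
have half (s : R) y : S y -> 0 < s <= r / 2 -> split_at U y s (1 / 10).
  move=> Sy /andP[s0 sr]; apply: IH => //; first by lra.
  by move: rn; rewrite exprS -mulrA; lra.
apply: (@split_of_energy U x r (1 / 10) (3 / 20) (pi / 2) p E D); rewrite -?SU//.
- by lra.
- by lra.
- by rewrite divr_gt0// pi_gt0.
- move=> y Sy; rewrite [in leRHS]SU; apply: split_hausdorff2 => //.
    by rewrite mulr_gt0.
  by apply: half => //; rewrite mulr_gt0//=; nra.
- apply: (two_sided_of_split r0 (lexx _)); apply: half => //.
  by rewrite divr_gt0//=.
Qed.

End scales.

Theorem theorem1p1 (R : realType) :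
  exists alpha : R, 0 < alpha /\
    forall (p E : R) (Sigma : set 'rV[R]_3),
      8 < p -> 0 < E -> lipschitz_surface Sigma ->
      (menger_curvature p Sigma <= E%:E)%E ->
      (((alpha `^ (5 * p) / E) `^ (1 / (p - 8)))%:E <= ediam Sigma)%E /\
      forall (x : 'rV[R]_3) (r : R), Sigma x ->
        0 < r -> r <= (alpha `^ (5 * p) / E) `^ (1 / (p - 8)) ->
        ((pi / 2 * r ^+ 2)%:E <= hausdorff2 (Sigma `&` ecball x r))%E.
Proof.
(* [(base_kernel * w) `^ p] stays below [base_kernel `^ p * base_mass ^+ 4] for all
   [p], since [w <= 1] gives [w `^ p <= w]. *)
pose w := Num.min (base_mass R ^+ 4) 1 / 2.
have k0 : 0 < base_kernel R.
  by apply: divr_gt0; [apply: exprn_gt0; lra|exact: ltr0n].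
have m0 : 0 < base_mass R.
  by rewrite mulr_gt0 ?divr_gt0 ?pi_gt0// exprn_gt0// /tolerance; lra.
have w0 : 0 < w by rewrite divr_gt0// lt_min exprn_gt0//=.
have w1 : w <= 1 by rewrite /w ler_pdivrMr// mul1r ge_min; apply/orP; right; lra.
have wm : w < base_mass R ^+ 4.
  have : Num.min (base_mass R ^+ 4) 1 <= base_mass R ^+ 4 by rewrite ge_min lexx.
  by rewrite /w in w0 *; lra.
exists ((base_kernel R * w) `^ (1 / 5)); split.
  by rewrite powR_gt0// mulr_gt0.
move=> p E S p8 E0 Ssurf SE.
have alphaE : ((base_kernel R * w) `^ (1 / 5)) `^ (5 * p) = (base_kernel R * w) `^ p.
  by rewrite -powRrM; congr (_ `^ _); field.
rewrite {}alphaE; set D := _ `^ p.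
have hD : 0 <= D < base_kernel R `^ p * base_mass R ^+ 4.
  rewrite powR_ge0/= /D powRM ?(ltW k0) ?(ltW w0)// ltr_pM2l ?powR_gt0//.
  apply: le_lt_trans wm; apply: ge1r_powR; first by rewrite w0.
  by lra.
have [_ _ [U [[U0 oU cU] bU] SU] _] := Ssurf.
have split_S := split_up_to Ssurf oU U0 bU SU p8 E0 SE hD.
split.
  have [x Sx] : exists x, S x.
    have [B [B0 UB]] := bounded_set_enorm bU.
    have nb : ~ U (vec3 (B + 1) 0 0).
      move=> /UB; rewrite /ecball /= subr0 => /(le_trans (ler_coord _ 0)).
      by rewrite vec3E ger0_norm; lra.
    have [u Uu] := U0.
    by have [t _ Ft] := segment_meets_frontier oU Uu nb; rewrite SU; eexists; exact: Ft.
  have RE0 : 0 < (D / E) `^ (1 / (p - 8)).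
    by rewrite powR_gt0// divr_gt0// powR_gt0// mulr_gt0.
  by rewrite [in leRHS]SU; apply: (split_ediam oU RE0 (split_S x _ Sx RE0 (lexx _))).
move=> x r Sx r0 rD; rewrite [in leRHS]SU.
by apply: (split_hausdorff2 oU r0); exact: split_S.
Qed.
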